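(* Let $(X,d)$ be a complete geodesic space, let $z\in X$, and let $\kappa,\lambda\in\mathbb R$. (i) If $(X,d)$ has curvature $\ge\kappa$ in the sense of Alexandrov in a neighborhood of $z$, then $\underline{\mathsf{Sec}}_z(\alpha,\beta)\ge\kappa$ for all linearly independent $\alpha,\beta\in\mathring T^{\mathsf{dir}}_zX$. (ii) If $(X,d)$ has curvature $\le\lambda$ in the sense of Alexandrov in a neighborhood of $z$, then $\overline{\mathsf{Sec}}_z(\alpha,\beta)\le\lambda$ for all linearly independent $\alpha,\beta\in\mathring T^{\mathsf{dir}}_zX$.
   Context: $\mathring T^{\mathsf{dir}}_zX$ is the set of (constant speed, minimizing) geodesics $\gamma=(\gamma_t)_{0\le t\le\tau}$ in $X$ with $\tau>0$, $\gamma_0=z$, modulo $\alpha\sim\beta$ iff $d_z(\alpha,\beta)=0$, where $d_z(\alpha,\beta)=\limsup_{t\to0}\frac1t d(\alpha_t,\beta_t)$. For $r>0$, $(r\alpha)_t=\alpha_{rt}$. $|\dot\alpha|$ is the metric speed and $\langle\alpha,\beta\rangle_z=\frac12\big(|\dot\alpha|^2+|\dot\beta|^2-d_z^2(\alpha,\beta)\big)=|\dot\alpha||\dot\beta|\cos\angle_z(\alpha,\beta)$, with $\angle_z$ the upper angle. $\alpha,\beta$ are linearly independent if $\angle_z(\alpha,\beta)\notin\{0,\pi\}$; equivalently $d_z(\alpha,\beta)\notin\{|\dot\alpha|+|\dot\beta|,\ \big||\dot\alpha|-|\dot\beta|\big|\}$. For linearly independent $\alpha,\beta$ put $$K(s,t)=3\,\frac{d_z^2(s\alpha,t\beta)-d^2(\alpha_s,\beta_t)}{s^2t^2\big(|\dot\alpha|^2|\dot\beta|^2-\langle\alpha,\beta\rangle_z^2\big)}.$$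 $\overline{\mathsf{Sec}}_z(\alpha,\beta)\le\lambda$ means $\limsup_jK(s_j,t_j)\le\lambda$, and $\underline{\mathsf{Sec}}_z(\alpha,\beta)\ge\kappa$ means $\liminf_jK(s_j,t_j)\ge\kappa$, for every sequence $(s_j,t_j)$ in $(0,\infty)^2$ with $s_j,t_j\to0$ and $\sup_j(s_j/t_j+t_j/s_j)<\infty$. Curvature bounds in the sense of Alexandrov are the usual ones, defined by triangle comparison with the model surface of constant curvature. *)

(* Defs.v *)
From HB Require Import structures.
From mathcomp Require Import all_boot all_order all_algebra.
From mathcomp Require Import all_classical all_reals all_analysis.

Set Implicit Arguments.
Unset Strict Implicit.
Unset Printing Implicit Defensive.

Import Order.TTheory GRing.Theory Num.Theory.
Import numFieldNormedType.Exports.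

Local Open Scope classical_set_scope.
Local Open Scope ring_scope.

#[short(type="completeMetricType")]
HB.structure Definition CompleteMetric (K : numDomainType) :=
  { M of Metric K M & Complete M }.

Section ModelSurface.
Context {R : realType}.
Implicit Types (k : R) (x y : 'rV[R]_3).

Definition euclid_form x y : R :=
  x 0 0 * y 0 0 + x 0 1 * y 0 1 + x 0 2%:R * y 0 2%:R.

Definition lorentz_form x y : R :=
  x 0 0 * y 0 0 - x 0 1 * y 0 1 - x 0 2%:R * y 0 2%:R.

Definition arcosh (u : R) : R := ln (u + Num.sqrt (u ^+ 2 - 1)).

(* The model surface of curvature k, realised in R^3: the unit sphere if k > 0,
   the affine plane x_0 = 1 if k = 0, and the upper sheet of the unit
   hyperboloid if k < 0. The intrinsic distance of the unit sphere or
   hyperboloid is rescaled by |k|^(-1/2). *)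
Definition model_surface k : set 'rV[R]_3 :=
  if 0 < k then [set x : 'rV[R]_3 | euclid_form x x = 1]
  else if k == 0 then [set x : 'rV[R]_3 | x 0 0 = 1]
  else [set x : 'rV[R]_3 | lorentz_form x x = 1 /\ 0 < x 0 0].

Definition model_dist k x y : R :=
  if 0 < k then acos (euclid_form x y) / Num.sqrt k
  else if k == 0 then
    Num.sqrt ((x 0 1 - y 0 1) ^+ 2 + (x 0 2%:R - y 0 2%:R) ^+ 2)
  else arcosh (lorentz_form x y) / Num.sqrt (- k).

End ModelSurface.

Section Geodesics.
Context {R : realType} {X : metricType R}.
Implicit Types (x y p z : X) (U : set X).

Definition constant_speed_geodesic (tau v : R) (g : R -> X) : Prop :=
  forall s t, 0 <= s <= tau -> 0 <= t <= tau ->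
    mdist (g s) (g t) = v * `|s - t|.

Definition geodesic_joining x y (g : R -> X) : Prop :=
  [/\ g 0 = x, g 1 = y & constant_speed_geodesic 1 (mdist x y) g].

Definition geodesic_space : Prop :=
  forall x y, exists g : R -> X, geodesic_joining x y g.

(* A triangle in U with vertices p, x, y: all three sides lie in U. *)
Definition geodesic_triangle U p x y (gpx gxy gyp : R -> X) : Prop :=
  [/\ geodesic_joining p x gpx, geodesic_joining x y gxy,
      geodesic_joining y p gyp
    & forall t, 0 <= t <= 1 -> [/\ U (gpx t), U (gxy t) & U (gyp t)]].

Definition comparison_triangle (k : R) p x y (p' x' y' : 'rV[R]_3) : Prop :=
  [/\ model_surface k p', model_surface k x' & model_surface k y'] /\
  [/\ model_dist k p' x' = mdist p x, model_dist k x' y' = mdist x y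
    & model_dist k y' p' = mdist y p].

(* The point w' of the model side [x', y'] corresponding to w in [x, y]. *)
Definition comparison_point (k : R) x y w (x' y' w' : 'rV[R]_3) : Prop :=
  [/\ model_surface k w', model_dist k x' w' = mdist x w
    & model_dist k w' y' = mdist w y].

Definition small_perimeter (k : R) p x y : Prop :=
  0 < k -> mdist p x + mdist x y + mdist y p < 2 * pi / Num.sqrt k.

Definition curvature_ge_on U (k : R) : Prop :=
  forall p x y gpx gxy gyp, geodesic_triangle U p x y gpx gxy gyp ->
  small_perimeter k p x y ->
  forall p' x' y' : 'rV[R]_3, comparison_triangle k p x y p' x' y' ->
  forall (t : R) (w' : 'rV[R]_3), 0 <= t <= 1 -> comparison_point k x y (gxy t) x' y' w' ->
  model_dist k p' w' <= mdist p (gxy t).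

Definition curvature_le_on U (k : R) : Prop :=
  forall p x y gpx gxy gyp, geodesic_triangle U p x y gpx gxy gyp ->
  small_perimeter k p x y ->
  forall p' x' y' : 'rV[R]_3, comparison_triangle k p x y p' x' y' ->
  forall (t : R) (w' : 'rV[R]_3), 0 <= t <= 1 -> comparison_point k x y (gxy t) x' y' w' ->
  mdist p (gxy t) <= model_dist k p' w'.

Definition curvature_ge_near z (k : R) : Prop :=
  exists2 U, nbhs z U & curvature_ge_on U k.

Definition curvature_le_near z (k : R) : Prop :=
  exists2 U, nbhs z U & curvature_le_on U k.

(* Representatives of the directions at z. The sectional curvature bounds
   below involve the actual geodesics, not only their d_z-classes, so they are
   stated for arbitrary representatives. Values of [geod_path] outside
   [0, geod_dom] are irrelevant. *)
Record geodesic_from z := GeodesicFrom {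
  geod_path :> R -> X;
  geod_dom : R;
  speed : R;
  geod_dom_gt0 : 0 < geod_dom;
  geod_path0 : geod_path 0 = z;
  geod_pathP : constant_speed_geodesic geod_dom speed geod_path }.

Lemma metric_speedE z (a : geodesic_from z) (t : R) : 0 < t < geod_dom a ->
  mdist (a u) (a t) / `|u - t| @[u --> t^'] --> speed a.
Proof.
move=> /andP[t0 tT].
apply: (@cvg_trans _ ((fun=> speed a) @ t^')); last exact: cvg_cst.
apply: near_eq_cvg; near=> u.
have tu : u != t by near: u; exact: nbhs_dnbhs_neq.
have u0 : 0 < u.
  by near: u; apply: nbhs_dnbhs; exact: lt_nbhsr.
have uT : u < geod_dom a.
  by near: u; apply: nbhs_dnbhs; exact: lt_nbhsl.
rewrite geod_pathP ?(ltW u0) ?(ltW uT) ?(ltW t0) ?(ltW tT)//.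
by rewrite mulfK// normr_eq0 subr_eq0.
Unshelve. all: by end_near. Qed.

Definition dir_dist (a b : R -> X) : R :=
  fine (limf_esup (fun t : R => (t^-1 * mdist (a t) (b t))%:E) (0 : R)^'+).

Definition rescale (r : R) (a : R -> X) : R -> X := fun t => a (r * t).

Definition comparison_angle p x y : R :=
  acos ((mdist p x ^+ 2 + mdist p y ^+ 2 - mdist x y ^+ 2) /
        (2 * mdist p x * mdist p y)).

Definition upper_angle z (a b : R -> X) : R :=
  fine (limf_esup (fun st : R * R => (comparison_angle z (a st.1) (b st.2))%:E)
    (filter_prod (0 : R)^'+ (0 : R)^'+)).

Definition dir_inner z (a b : geodesic_from z) : R :=
  (speed a ^+ 2 + speed b ^+ 2 - dir_dist a b ^+ 2) / 2.

(* The angle is only meaningful for nonconstant geodesics. *)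
Definition linearly_independent z (a b : geodesic_from z) : Prop :=
  [/\ 0 < speed a, 0 < speed b, upper_angle z a b <> 0
    & upper_angle z a b <> pi].

Definition sec_quotient z (a b : geodesic_from z) (s t : R) : R :=
  3 * ((dir_dist (rescale s a) (rescale t b) ^+ 2 - mdist (a s) (b t) ^+ 2) /
       (s ^+ 2 * t ^+ 2 *
        (speed a ^+ 2 * speed b ^+ 2 - dir_inner a b ^+ 2))).

Definition comparable_null_sequences (s t : R^nat) : Prop :=
  [/\ forall j, 0 < s j /\ 0 < t j, s @ \oo --> (0 : R), t @ \oo --> (0 : R)
    & exists C : R, forall j, s j / t j + t j / s j <= C].

Definition lower_sec_ge z (a b : geodesic_from z) (k : R) : Prop :=
  forall s t, comparable_null_sequences s t ->
    (k%:E <= limn_einf (fun j => (sec_quotient a b (s j) (t j))%:E))%E.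

Definition upper_sec_le z (a b : geodesic_from z) (l : R) : Prop :=
  forall s t, comparable_null_sequences s t ->
    (limn_esup (fun j => (sec_quotient a b (s j) (t j))%:E) <= l%:E)%E.

End Geodesics.

Arguments geodesic_space {R} X.

(* Main.v *)
Require Import Defs.
From mathcomp Require Import all_boot all_order all_algebra.
From mathcomp Require Import all_classical all_reals all_analysis.
From mathcomp Require Import ring lra.

Set Implicit Arguments.
Unset Strict Implicit.
Unset Printing Implicit Defensive.

Import Order.TTheory GRing.Theory Num.Theory.
Import numFieldNormedType.Exports.

Local Open Scope classical_set_scope.
Local Open Scope ring_scope.

(** Write [u = |a'| s] and [v = |b'| t] for the legs of the hinge formed by [a s],
    [z] and [b t], and [d] for the distance of its endpoints.  Its comparison
    angle of curvature [k] is the angle between sides of lengths [u] and [v] of a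
    triangle in the model surface whose third side has length [d]; let A(s, t)
    be the cosine of this angle.

    Triangle comparison for the triangle with vertices [b t], [z], [a s] and a
    point of the side from [z] to [a s] says that A is monotone in [s], and
    likewise in [t]: nondecreasing if the curvature is bounded below, and
    nonincreasing if it is bounded above ([hinge_cos_monotone]).  Hence A has a
    limit [c] at the origin, which bounds it from below, respectively from
    above ([angle_cosine_ge], [angle_cosine_le]).  As the model law of cosines is
    Euclidean to leading order, the distance between rays is given by the
    Euclidean law of cosines with cosine [c] ([ray_distance]).  Therefore
    [d_z(s a, t b)^2 = q] with [q = u^2 + v^2 - 2 u v c], the inner product of
    [a] and [b] is [|a'| |b'| c], and linear independence means that [c^2 < 1]
    ([linearly_independent_cos]).

    With these values the sectional quotient is
    [K = 3 (q - d^2) / (u^2 v^2 (1 - c^2))].  The expansion of the model law of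
    cosines ([law_of_cosines_expansion]) shows that, up to an error of order six
    in the size of the hinge,
    [6 sn(u) sn(v) (A - c) = u^2 v^2 (1 - c^2) (K (1 - k (q + d^2) / 12) - k)],
    where sn is the sine of curvature [k].  As the legs stay comparable,
    [u^2 v^2] is of order exactly four, so that the sign of [A - c] forces
    [K >= k - o(1)], respectively [K <= k + o(1)]
    ([normalized_defect_bounds]). *)

(** * Generalised trigonometric functions *)

Section GeneralizedTrig.
Context {R : realType}.
Implicit Types k u v x : R.

(** The sine of curvature [k]: the solution of [f'' = - k f] with [f 0 = 0] and
    [f' 0 = 1]. *)
Definition gsn k x : R :=
  if 0 < k then sin (Num.sqrt k * x) / Num.sqrt k
  else if k == 0 then x
  else (expR (Num.sqrt (- k) * x) - expR (- (Num.sqrt (- k) * x))) /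
       (2 * Num.sqrt (- k)).

(** The modified distance of curvature [k]: the primitive of [gsn k] that
    vanishes at 0.  The cosine of curvature [k] is [1 - k * gmd k x]; working
    with [gmd] instead of the cosine keeps [k = 0] on the same footing as the
    other cases. *)
Definition gmd k x : R :=
  if 0 < k then (1 - cos (Num.sqrt k * x)) / k
  else if k == 0 then x ^+ 2 / 2
  else (1 - (expR (Num.sqrt (- k) * x) + expR (- (Num.sqrt (- k) * x))) / 2) / k.

Lemma curvature_sign k :
  [\/ 0 < k /\ 0 < Num.sqrt k, k = 0 | [/\ k < 0, 0 < k = false, k == 0 = false & 0 < Num.sqrt (- k)]].
Proof.
have [k0|k0|->] := ltgtP k 0; last by apply: Or32.
- by apply: Or33; split => //; rewrite sqrtr_gt0 oppr_gt0.
- by apply: Or31; rewrite sqrtr_gt0.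
Qed.

Lemma gmd0 k : gmd k 0 = 0.
Proof.
rewrite /gmd; case: ifP => [_|_]; first by rewrite mulr0 cos0 subrr mul0r.
case: ifP => [_|_]; first by rewrite expr0n mul0r.
by rewrite mulr0 oppr0 expR0 -mulr2n -[1 *+ 2]/(2%:R) divff ?subrr ?mul0r // pnatr_eq0.
Qed.

Lemma gsn0 k : gsn k 0 = 0.
Proof.
rewrite /gsn; case: ifP => [_|_]; first by rewrite mulr0 sin0 mul0r.
by case: ifP => // _; rewrite mulr0 oppr0 subrr mul0r.
Qed.

Lemma gmdN k x : gmd k (- x) = gmd k x.
Proof. by rewrite /gmd !mulrN cosN opprK sqrrN [expR (- _) + _]addrC. Qed.

Lemma gmd_norm k x : gmd k `|x| = gmd k x.
Proof. by case: (ler0P x) => // _; rewrite gmdN. Qed.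

Lemma gsnN k x : gsn k (- x) = - gsn k x.
Proof.
rewrite /gsn !mulrN sinN opprK; case: ifP => _; first by rewrite mulNr.
by case: ifP => // _; rewrite -opprB mulNr.
Qed.

Lemma is_derive_gmd k x : is_derive x 1 (gmd k) (gsn k x).
Proof.
rewrite /gmd /gsn; case: (curvature_sign k) => [[k0 r0]|->|[_ -> -> r0]].
- rewrite k0.
  have -> : (fun x => (1 - cos (Num.sqrt k * x)) / k) =
    (fun x => k^-1 *: (1 - cos (Num.sqrt k *: x))).
    by apply/funext => y; rewrite -[RHS]/(_ * _) mulrC.
  apply: is_derive_eq.
  rewrite /GRing.scale /=.
  have -> : k^-1 = (Num.sqrt k)^-1 ^+ 2 by rewrite exprVn sqr_sqrtr // ltW.
  field. by rewrite gt_eqF.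
- rewrite ltxx eqxx.
  have -> : (fun x : R => x ^+ 2 / 2) = (fun x => 2^-1 *: x ^+ 2).
    by apply/funext => y; rewrite -[RHS]/(_ * _) mulrC.
  apply: is_derive_eq.
  by rewrite /GRing.scale /=; field.
- set r := Num.sqrt _ in r0 *.
  have kE : k = - r ^+ 2.
   rewrite sqr_sqrtr ?opprK //; by have := r0; rewrite sqrtr_gt0 => /ltW.
  have -> : (fun x => (1 - (expR (r * x) + expR (- (r * x))) / 2) / k) =
    (fun x => k^-1 *: (1 - 2^-1 *: (expR (r *: x) + expR ((- r) *: x)))).
    apply/funext => y; rewrite /GRing.scale /= mulNr.
    by rewrite -[LHS]mulrC [_ / 2]mulrC.
  apply: is_derive_eq.
  rewrite /GRing.scale /= kE mulNr.
  field. by rewrite gt_eqF.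
Qed.

Lemma is_derive_gsn k x : is_derive x 1 (gsn k) (1 - k * gmd k x).
Proof.
rewrite /gmd /gsn; case: (curvature_sign k) => [[k0 r0]|->|[k0 -> -> r0]].
- rewrite k0.
  have -> : (fun x => sin (Num.sqrt k * x) / Num.sqrt k) =
    (fun x => (Num.sqrt k)^-1 *: (sin (Num.sqrt k *: x))).
    by apply/funext => y; rewrite -[RHS]/(_ * _) mulrC.
  apply: is_derive_eq.
  rewrite /GRing.scale /= mulr1.
  field. by rewrite !gt_eqF.
- rewrite ltxx eqxx mul0r subr0. 
  exact: is_derive_id.
- set r := Num.sqrt _ in r0 *.
  have -> : (fun x => (expR (r * x) - expR (- (r * x))) / (2 * r)) =
    (fun x => (2 * r)^-1 *: (expR (r *: x) - expR ((- r) *: x))).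
    apply/funext => y; rewrite /GRing.scale /= mulNr.
    by rewrite -[LHS]mulrC.
  apply: is_derive_eq.
  rewrite /GRing.scale /= mulNr.
  field. by rewrite ?(gt_eqF r0) ?(lt_eqF k0).
Qed.

(** The Pythagorean identity and the addition formula, in terms of [gmd]. *)
Lemma gsn_sqr k x : gsn k x ^+ 2 = 2 * gmd k x - k * gmd k x ^+ 2.
Proof.
rewrite /gmd /gsn; case: (curvature_sign k) => [[k0 r0]|->|[k0 -> -> r0]].
- rewrite k0 expr_div_n sqr_sqrtr ?ltW // sin2cos2.
  field. by rewrite gt_eqF.
- by rewrite ltxx eqxx; field.
- have kE : k = - Num.sqrt (- k) ^+ 2.
    by rewrite sqr_sqrtr ?opprK // oppr_ge0; apply: ltW.
  set r := Num.sqrt _ in r0 kE *; rewrite kE expRN.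
  field. by rewrite !gt_eqF ?expR_gt0.
Qed.

Lemma gmdB k u v :
  gmd k (u - v) = gmd k u + gmd k v - k * gmd k u * gmd k v - gsn k u * gsn k v.
Proof.
rewrite /gmd /gsn; case: (curvature_sign k) => [[k0 r0]|->|[k0 -> -> r0]].
- rewrite k0 mulrBr cosB.
  have -> : forall a b : R, a / Num.sqrt k * (b / Num.sqrt k) = a * b / k.
    move=> a b; rewrite mulrACA -invfM -expr2 sqr_sqrtr //; exact: ltW.
  field. by rewrite gt_eqF.
- by rewrite ltxx eqxx; field.
- have kE : k = - Num.sqrt (- k) ^+ 2.
    by rewrite sqr_sqrtr ?opprK // oppr_ge0; apply: ltW.
  set r := Num.sqrt _ in r0 kE *; rewrite kE !expRN mulrBr expRB.
  field. by rewrite !gt_eqF ?expR_gt0.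
Qed.

Lemma gmdD k u v :
  gmd k (u + v) = gmd k u + gmd k v - k * gmd k u * gmd k v + gsn k u * gsn k v.
Proof. by rewrite -{1}(opprK v) gmdB gmdN gsnN mulrN opprK. Qed.

Lemma gsn_gt0 k x : (0 < k -> Num.sqrt k * x < pi) -> 0 < x -> 0 < gsn k x.
Proof.
rewrite /gsn => kx x0; case: (curvature_sign k) kx => [[k0 r0]|->|[k0 -> -> r0]].
- rewrite k0 => /(_ isT) kx; rewrite divr_gt0 // sin_gt0_pi // kx andbT.
  exact: mulr_gt0.
- by rewrite ltxx eqxx.
- move=> _; rewrite divr_gt0 ?mulr_gt0 // subr_gt0 ltr_expR.
  by rewrite gtrN ?mulr_gt0.
Qed.

Lemma continuous_gmd k : continuous (gmd k).
Proof.
move=> x; apply: differentiable_continuous; apply/derivable1_diffP.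
by have [] := is_derive_gmd k x.
Qed.

(** The hypothesis [0 < k -> sqrt k * v <= pi] says that [v] is at most the
    diameter of the model surface. *)
Lemma gmd_lt k u v : (0 < k -> Num.sqrt k * v <= pi) ->
  0 <= u -> u < v -> gmd k u < gmd k v.
Proof.
move=> kv u0 uv.
have [x xuv E] := @MVT _ (gmd k) (gsn k) u v uv
  (fun x _ => is_derive_gmd k x) (continuous_subspaceT (@continuous_gmd k)).
rewrite -subr_gt0 E mulr_gt0 ?subr_gt0 //; move: xuv; rewrite in_itv /= => /andP[ux xv].
apply: gsn_gt0 => [k0|]; last exact: le_lt_trans ux.
by apply: lt_le_trans (kv k0); rewrite ltr_pM2l // sqrtr_gt0.
Qed.

Lemma gmd_le k u v : (0 < k -> Num.sqrt k * v <= pi) ->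
  0 <= u -> u <= v -> gmd k u <= gmd k v.
Proof.
move=> kv u0; rewrite le_eqVlt => /orP[/eqP->//|uv]; apply: ltW; exact: gmd_lt.
Qed.

End GeneralizedTrig.

(** * Hinges in the model surfaces *)

Section ModelHinge.
Context {R : realType}.
Implicit Types (k u v r c s x : R).

(** The point at distance [u] from the base point [(1, 0, 0)] of the model
    surface, in the direction of cosine [c] and sine [s].  The model surface has
    unit radius when [k != 0], hence the factor [sqrt |k|]. *)
Definition model_point k u c s : 'rV[R]_3 :=
  let w := if k == 0 then 1 else Num.sqrt `|k| in
  \row_(i < 3) [:: 1 - k * gmd k u; w * gsn k u * c; w * gsn k u * s]`_i.

Lemma model_scale_sqr k :
  k != 0 -> (if k == 0 then 1 else Num.sqrt `|k|) ^+ 2 = `|k|.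
Proof. by move=> /negbTE ->; rewrite sqr_sqrtr. Qed.

Lemma gmd_ge0 k u : (0 < k -> Num.sqrt k * `|u| <= pi) -> 0 <= gmd k u.
Proof. by move=> ku; rewrite -gmd_norm -(gmd0 k); exact: gmd_le. Qed.

Lemma model_surface_point k u c s : c ^+ 2 + s ^+ 2 = 1 ->
  model_surface k (model_point k u c s).
Proof.
move=> cs1; rewrite /model_surface.
case: (curvature_sign k) => [[k0 r0]|k0|[k0 k0' k0'' r0]].
- rewrite k0 /= /euclid_form !mxE /=.
  have k1 : k != 0 by rewrite gt_eqF.
  have := model_scale_sqr k1; set w := (if _ then _ else _) => wE.
  transitivity ((1 - k * gmd k u) ^+ 2 + w ^+ 2 * gsn k u ^+ 2 * (c ^+ 2 + s ^+ 2)).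
    by ring.
  by rewrite wE cs1 gsn_sqr gtr0_norm //; ring.
- by rewrite k0 ltxx eqxx /= !mxE /= mul0r subr0.
- rewrite k0' k0'' /= /lorentz_form !mxE /=; split; last first.
    by rewrite subr_gt0 (le_lt_trans _ ltr01)// nmulr_rle0 // gmd_ge0 // k0'.
  have k1 : k != 0 by rewrite lt_eqF.
  have := model_scale_sqr k1; set w := (if _ then _ else _) => wE.
  transitivity ((1 - k * gmd k u) ^+ 2 - w ^+ 2 * gsn k u ^+ 2 * (c ^+ 2 + s ^+ 2)).
    by ring.
  by rewrite wE cs1 gsn_sqr ltr0_norm //; ring.
Qed.

Lemma arcosh_cosh x : 0 <= x -> arcosh ((expR x + expR (- x)) / 2) = x.
Proof.
move=> x0; rewrite /arcosh.
have -> : ((expR x + expR (- x)) / 2) ^+ 2 - 1 = ((expR x - expR (- x)) / 2) ^+ 2.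
  by rewrite expRN; field; rewrite gt_eqF // expR_gt0.
rewrite sqrtr_sqr ger0_norm; last first.
  by rewrite divr_ge0 // subr_ge0 ler_expR ge0_cp.
have -> : (expR x + expR (- x)) / 2 + (expR x - expR (- x)) / 2 = expR x by field.
exact: expRK.
Qed.

(** The law of cosines in the model surface, solved for the distance. *)
Lemma model_dist_point k u v c s c' s' r :
  0 <= r -> (0 < k -> Num.sqrt k * r <= pi) ->
  c ^+ 2 + s ^+ 2 = 1 -> c' ^+ 2 + s' ^+ 2 = 1 ->
  gmd k r = gmd k u + gmd k v - k * gmd k u * gmd k v -
    gsn k u * gsn k v * (c * c' + s * s') ->
  model_dist k (model_point k u c s) (model_point k v c' s') = r.
Proof.
move=> r0 kr cs1 cs1'; rewrite /model_dist.
case: (curvature_sign k) kr => [[k0 q0]|->|[k0 k0' k0'' q0]] kr.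
- rewrite k0 /= /euclid_form !mxE /= => E.
  have k1 : k != 0 by rewrite gt_eqF.
  have := model_scale_sqr k1; set w := (if _ then _ else _) => wE.
  have -> : (1 - k * gmd k u) * (1 - k * gmd k v) +
    w * gsn k u * c * (w * gsn k v * c') + w * gsn k u * s * (w * gsn k v * s') =
    cos (Num.sqrt k * r).
    have -> : cos (Num.sqrt k * r) = 1 - k * gmd k r.
      by rewrite /gmd k0; field.
    transitivity (1 - k * (gmd k u + gmd k v - k * gmd k u * gmd k v) +
       w ^+ 2 * gsn k u * gsn k v * (c * c' + s * s')); first by ring.
    by rewrite wE E gtr0_norm //; ring.
  rewrite cosK; first by rewrite mulrAC divff ?mul1r // gt_eqF.
  by rewrite in_itv /= kr // andbT mulr_ge0 // ltW.
- rewrite ltxx eqxx /= !mxE /= /gmd /gsn ltxx eqxx !mul0r !mul1r subr0 => E.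
  have -> : (u * c - v * c') ^+ 2 + (u * s - v * s') ^+ 2 = r ^+ 2.
    transitivity (2 * (u ^+ 2 / 2 * (c ^+ 2 + s ^+ 2) +
      v ^+ 2 / 2 * (c' ^+ 2 + s' ^+ 2)  - u * v * (c * c' + s * s'))).
      by field.
    by rewrite cs1 cs1' !mulr1 -E; field.
  by rewrite sqrtr_sqr ger0_norm.
- rewrite k0' k0'' /= /lorentz_form !mxE /= => E.
  have k1 : k != 0 by rewrite lt_eqF.
  have := model_scale_sqr k1; set w := (if _ then _ else _) => wE.
  have -> : (1 - k * gmd k u) * (1 - k * gmd k v) -
    w * gsn k u * c * (w * gsn k v * c') - w * gsn k u * s * (w * gsn k v * s') =
    (expR (Num.sqrt (- k) * r) + expR (- (Num.sqrt (- k) * r))) / 2.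
    have -> : (expR (Num.sqrt (- k) * r) + expR (- (Num.sqrt (- k) * r))) / 2
       = 1 - k * gmd k r.
      by rewrite /gmd k0' k0''; field.
    transitivity (1 - k * (gmd k u + gmd k v - k * gmd k u * gmd k v) -
       w ^+ 2 * gsn k u * gsn k v * (c * c' + s * s')); first by ring.
    by rewrite wE E ltr0_norm //; ring.
  rewrite arcosh_cosh; last by rewrite mulr_ge0 // ltW.
  by rewrite mulrAC divff ?mul1r // gt_eqF.
Qed.

(** The cosine of the angle between the sides of lengths [u] and [v] of a
    triangle in the model surface whose third side has length [d]. *)
Definition model_cos k d u v : R :=
  (gmd k u + gmd k v - k * gmd k u * gmd k v - gmd k d) / (gsn k u * gsn k v).

Lemma model_cosC k d u v : model_cos k d u v = model_cos k d v u.
Proof.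
by rewrite /model_cos [gsn k u * _]mulrC; congr (_ / _); ring.
Qed.

(** The triangle inequality makes [model_cos] a cosine: the values 1 and -1 are
    those of the degenerate triangles [d = |u - v|] and [d = u + v]. *)
Lemma model_cos_bound k d u v : 0 < u -> 0 < v ->
  (0 < k -> Num.sqrt k * (u + v) < pi) ->
  `|u - v| <= d -> d <= u + v -> `|model_cos k d u v| <= 1.
Proof.
move=> u0 v0 kuv uvd duv.
have kle x : x <= u + v -> 0 < k -> Num.sqrt k * x < pi.
  move=> xuv k0; apply: le_lt_trans (kuv k0).
  by rewrite ler_pM2l // sqrtr_gt0.
have su : 0 < gsn k u by apply: gsn_gt0 => //; apply: kle; rewrite lerDl ltW.
have sv : 0 < gsn k v by apply: gsn_gt0 => //; apply: kle; rewrite lerDr ltW.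
have d0 : 0 <= d by apply: le_trans uvd.
rewrite /model_cos ler_norml ler_pdivlMr ?ler_pdivrMr ?mulr_gt0 //.
have h1 : gmd k (u - v) <= gmd k d.
  by rewrite -gmd_norm; apply: gmd_le => // k0; apply/ltW/kle.
have h2 : gmd k d <= gmd k (u + v).
  by apply: gmd_le => // k0; apply/ltW/kle.
move: h1 h2; rewrite gmdB gmdD; lra.
Qed.

(** A hinge with legs [u] and [v] and third side [d] is realised in the model
    surface, with vertex [x'], and [w'] at distance [u1] from [x'] on the leg of
    length [u].  The distance from [w'] to the endpoint [p'] of the other leg is
    then controlled by the law of cosines. *)
Lemma model_hinge k u u1 v d : 0 <= u1 -> u1 <= u -> 0 < u -> 0 < v ->
  (0 < k -> Num.sqrt k * (u + v) < pi) ->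
  `|u - v| <= d -> d <= u + v ->
  exists p' x' y' w' : 'rV[R]_3,
  [/\ model_surface k p', model_surface k x', model_surface k y' &
      model_surface k w'] /\
  [/\ model_dist k p' x' = v, model_dist k x' y' = u, model_dist k y' p' = d,
      model_dist k x' w' = u1 & model_dist k w' y' = u - u1] /\
  exists r, [/\ model_dist k p' w' = r, 0 <= r <= u1 + v &
    gmd k r = gmd k u1 + gmd k v - k * gmd k u1 * gmd k v
      - gsn k u1 * gsn k v * model_cos k d u v].
Proof.
move=> u10 u1u u0 v0 kuv uvd duv.
have kle x : x <= u + v -> 0 < k -> Num.sqrt k * x < pi.
  move=> xuv k0; apply: le_lt_trans (kuv k0).
  by rewrite ler_pM2l // sqrtr_gt0.
have kleW x : x <= u + v -> 0 < k -> Num.sqrt k * x <= pi.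
  by move=> ? ?; apply/ltW/kle.
have d0 : 0 <= d by apply: le_trans uvd.
have su : 0 < gsn k u by apply: gsn_gt0 => //; apply: kle; rewrite lerDl ltW.
have sv : 0 < gsn k v by apply: gsn_gt0 => //; apply: kle; rewrite lerDr ltW.
have su1 : 0 <= gsn k u1.
  move: u10; rewrite le_eqVlt => /orP[/eqP<-|u10]; first by rewrite gsn0.
  apply/ltW/gsn_gt0 => //; apply: kle; rewrite (le_trans u1u) // lerDl; exact: ltW.
have := model_cos_bound u0 v0 kuv uvd duv.
set c := model_cos k d u v => c1.
have cs1 : c ^+ 2 + Num.sqrt (1 - c ^+ 2) ^+ 2 = 1.
  rewrite sqr_sqrtr; first by ring.
  by move: c1; rewrite ler_norml => /andP[]; nra.
have e1 : 1 ^+ 2 + 0 ^+ 2 = 1 :> R by rewrite expr1n expr0n addr0.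
(* The vertex is the base point, and the leg of length [u] leaves it in the
   direction of angle 0. *)
exists (model_point k v c (Num.sqrt (1 - c ^+ 2))), (model_point k 0 1 0),
  (model_point k u 1 0), (model_point k u1 1 0).
split; first by split; exact: model_surface_point.
split; first split.
- apply: model_dist_point => //; first exact: ltW.
    by apply: kleW; rewrite lerDr ltW.
  by rewrite gmd0 gsn0; ring.
- apply: model_dist_point => //; first exact: ltW.
    by apply: kleW; rewrite lerDl ltW.
  by rewrite gmd0 gsn0; ring.
- apply: model_dist_point => //; first exact: kleW.
  rewrite mul1r mul0r addr0 /c /model_cos; field.
  by rewrite !gt_eqF.
- apply: model_dist_point => //.
    by apply: kleW; rewrite (le_trans u1u) // lerDl ltW.
  by rewrite gmd0 gsn0; ring.
- apply: model_dist_point => //; first by rewrite subr_ge0.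
    by apply: kleW; lra.
  by rewrite gmdB; ring.
(* The law of cosines is solved for the length [r] by the intermediate value
   theorem. *)
set m := gmd k u1 + _ - _ - _.
have mB : gmd k (u1 - v) <= m <= gmd k (u1 + v).
  rewrite gmdB gmdD /m.
  have s0 : 0 <= gsn k u1 * gsn k v by rewrite mulr_ge0 // ltW.
  by move: c1; rewrite ler_norml => /andP[]; nra.
have [r] : exists2 r, r \in `[0, u1 + v] & gmd k r = m.
  apply: IVT; first by rewrite addr_ge0 // ltW.
    by apply: continuous_subspaceT; exact: continuous_gmd.
  have le0 : 0 <= m.
    case/andP: mB => + _; apply: le_trans; apply: gmd_ge0; apply: kleW.
    by rewrite ler_norml; apply/andP; split; lra.
  rewrite gmd0 ge_min le_max le0 /=.
  by case/andP: mB => _ ->; rewrite orbT.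
rewrite in_itv /= => ruv rm; exists r; split => //.
apply: model_dist_point => //; first by case/andP: ruv.
  by apply: kleW; case/andP: ruv => _ /le_trans; apply; rewrite lerD2r.
by rewrite rm /m; ring.
Qed.

End ModelHinge.

(** * The law of cosines to fourth order *)

Section Expansion.
Context {R : realType}.
Implicit Types (k u v d c x r M : R).

Lemma bound_of_derivative (f df : R -> R) M (n : nat) :
  (forall x : R, is_derive x (1 : R) f (df x)) -> f 0 = 0 ->
  (forall x, 0 <= x <= 1 -> `|df x| <= M * x ^+ n) ->
  forall x, 0 <= x <= 1 -> `|f x| <= M * x ^+ n.+1.
Proof.
move=> fdf f0 dfM x /andP[]; rewrite le_eqVlt => /orP[/eqP<- _|x0 x1].
  by rewrite f0 normr0 exprS mul0r mulr0.
have fc : continuous f.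
  move=> y; apply: differentiable_continuous; apply/derivable1_diffP.
  by have [] := fdf y.
have [y yx] := @MVT _ f df 0 x x0 (fun y _ => fdf y) (continuous_subspaceT fc).
rewrite f0 !subr0 => ->; move: yx; rewrite in_itv /= => /andP[y0 yx].
have yM := dfM y; have {}yM : `|df y| <= M * y ^+ n.
  by apply: yM; rewrite ltW //= ltW // (lt_le_trans yx).
have M0 : 0 <= M.
  have := le_trans (normr_ge0 _) yM; rewrite pmulr_lge0 //; exact: exprn_gt0.
rewrite normrM (gtr0_norm x0) exprSr mulrA ler_pM2r //.
apply: le_trans yM _; rewrite ler_wpM2l // lerXn2r ?nnegrE // ltW //.
Qed.

(** Taylor bounds for [gsn] and [gmd], each obtained by integrating the one for
    its derivative, starting from a bound of the cosine on the unit interval. *)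
Lemma gtrig_taylor k : exists2 M, 0 < M & forall x, 0 <= x <= 1 ->
  [/\ `|gsn k x| <= M * x, `|gmd k x| <= M * x ^+ 2,
      `|gmd k x - x ^+ 2 / 2| <= M * x ^+ 4,
      `|gsn k x - (x - k * x ^+ 3 / 6)| <= M * x ^+ 5 &
      `|gmd k x - (x ^+ 2 / 2 - k * x ^+ 4 / 24)| <= M * x ^+ 6].
Proof.
have gdc : continuous (fun x => `|1 - k * gmd k x|).
  move=> x; apply: (@continuous_comp _ _ _ (fun x => 1 - k * gmd k x) Num.norm).
    apply: cvgB; first exact: cvg_cst.
    by apply: cvgM; [exact: cvg_cst | exact: continuous_gmd].
  exact: norm_continuous.
have [x0 _ hx0] := EVT_max (@ler01 R) (continuous_subspaceT gdc).
set L := `|1 - k * gmd k x0| in hx0.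
have L0 : 0 <= L by exact: normr_ge0.
have b1 : forall x, 0 <= x <= 1 -> `|gsn k x| <= L * x ^+ 1.
  apply: (bound_of_derivative (is_derive_gsn k)); first exact: gsn0.
  by move=> x x01; rewrite expr0 mulr1; apply: hx0; rewrite in_itv.
have b2 : forall x, 0 <= x <= 1 -> `|gmd k x| <= L * x ^+ 2.
  by apply: (bound_of_derivative (is_derive_gmd k)) => //; exact: gmd0.
have kb (g : R -> R) x M n : 0 <= x <= 1 -> `|g x| <= M * x ^+ n ->
    `|- k * g x| <= `|k| * M * x ^+ n.
  by move=> _ h; rewrite normrM normrN -mulrA ler_wpM2l.
have b3 : forall x, 0 <= x <= 1 -> `|gsn k x - x| <= `|k| * L * x ^+ 3.
  apply: (@bound_of_derivative _ (fun x => - k * gmd k x)); last first.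
  - by move=> x x01; apply: kb => //; exact: b2.
  - by rewrite gsn0 subrr.
  move=> x; have := is_derive_gsn k x => h.
  by apply: is_derive_eq; rewrite /=; ring.
have b4 : forall x, 0 <= x <= 1 -> `|gmd k x - x ^+ 2 / 2| <= `|k| * L * x ^+ 4.
  apply: (@bound_of_derivative _ (fun x => gsn k x - x)) => //; last first.
  - by rewrite gmd0 expr0n mul0r subrr.
  move=> x; have := is_derive_gmd k x => h.
  have -> : (fun x => gmd k x - x ^+ 2 / 2) = (fun x => gmd k x - 2^-1 *: x ^+ 2).
    by apply/funext => y; rewrite /GRing.scale /= [2^-1 * _]mulrC.
  by apply: is_derive_eq; rewrite /GRing.scale /=; field.
have b5 : forall x, 0 <= x <= 1 ->
    `|gsn k x - (x - k * x ^+ 3 / 6)| <= `|k| * (`|k| * L) * x ^+ 5.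
  apply: (@bound_of_derivative _ (fun x => - k * (gmd k x - x ^+ 2 / 2))); last first.
  - by move=> x x01; apply: (kb (fun x => gmd k x - x ^+ 2 / 2)) => //; exact: b4.
  - by rewrite gsn0 expr0n /= mulr0 mul0r !subrr.
  move=> x; have := is_derive_gsn k x => h.
  have -> : (fun x => gsn k x - (x - k * x ^+ 3 / 6)) =
      (fun x => gsn k x - (x - (k / 6) *: x ^+ 3)).
    by apply/funext => y; rewrite /GRing.scale /=; field.
  by apply: is_derive_eq; rewrite /GRing.scale /=; field.
have b6 : forall x, 0 <= x <= 1 ->
    `|gmd k x - (x ^+ 2 / 2 - k * x ^+ 4 / 24)| <= `|k| * (`|k| * L) * x ^+ 6.
  apply: (bound_of_derivative _ _ b5).
  - move=> x; have := is_derive_gmd k x => h.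
    have -> : (fun x => gmd k x - (x ^+ 2 / 2 - k * x ^+ 4 / 24)) =
        (fun x => gmd k x - (2^-1 *: x ^+ 2 - (k / 24) *: x ^+ 4)).
      by apply/funext => y; rewrite /GRing.scale /=; field.
    by apply: is_derive_eq; rewrite /GRing.scale /=; field.
  - by rewrite gmd0 !expr0n /= mulr0 !mul0r !subrr.
have k0 := normr_ge0 k.
exists ((1 + `|k| + `|k| ^+ 2) * (L + 1)).
  by apply: mulr_gt0; nra.
move=> x x01; have xge0 : 0 <= x by case/andP: x01.
have up M n : M <= (1 + `|k| + `|k| ^+ 2) * (L + 1) -> forall y : R,
   y <= M * x ^+ n -> y <= (1 + `|k| + `|k| ^+ 2) * (L + 1) * x ^+ n.
  by move=> hM y /le_trans; apply; rewrite ler_wpM2r // exprn_ge0.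
split.
- rewrite -{2}[x]expr1; apply: (up _ _ _ _ (b1 x x01)); nra.
- apply: (up _ _ _ _ (b2 x x01)); nra.
- apply: (up _ _ _ _ (b4 x x01)); nra.
- apply: (up _ _ _ _ (b5 x x01)); nra.
- apply: (up _ _ _ _ (b6 x x01)); nra.
Qed.

(** The defect in the model law of cosines for a triangle of sides [u], [v] and
    [d] and an angle of cosine [c], up to an error of order six in the scale [r]
    of the triangle.  The Euclidean defect [e] enters at order two; the curvature
    enters at order four, through the term [u^2 v^2 (1 - c^2)]. *)
Lemma law_of_cosines_expansion k : exists2 M, 0 < M & forall r u v d c,
  0 <= u <= r -> 0 <= v <= r -> 0 <= d <= 2 * r -> 2 * r <= 1 -> `|c| <= 1 ->
  forall q e, q = u ^+ 2 + v ^+ 2 - 2 * u * v * c -> e = q - d ^+ 2 ->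
  `|(gmd k u + gmd k v - k * gmd k u * gmd k v - gmd k d - gsn k u * gsn k v * c)
   - (e / 2 - k / 6 * (u ^+ 2 * v ^+ 2 * (1 - c ^+ 2)) - k / 24 * e * (q + d ^+ 2))|
  <= M * r ^+ 6.
Proof.
have [M M0 HM] := gtrig_taylor k.
exists (66 * M + `|k| * (M * M + M) + (M * M + (1 + `|k|) * M + `|k| ^+ 2)).
  have := normr_ge0 k; nra.
move=> r u v d c /andP[u0 ur] /andP[v0 vr] /andP[d0 dr] r1 c1 q e qE eE.
have r0 : 0 <= r := le_trans u0 ur.
have u01 : 0 <= u <= 1 by rewrite u0 /=; lra.
have v01 : 0 <= v <= 1 by rewrite v0 /=; lra.
have d01 : 0 <= d <= 1 by rewrite d0 /=; lra.
have [su mu mu4 su5 mu6] := HM u u01.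
have [sv mv mv4 sv5 mv6] := HM v v01.
have [_ _ _ _ md6] := HM d d01.
set A := gmd k u - _ in mu6; set B := gmd k v - _ in mv6; set D := gmd k d - _ in md6.
pose E := gmd k u * gmd k v - u ^+ 2 / 2 * (v ^+ 2 / 2).
pose P x := x - k * x ^+ 3 / 6.
pose S := gsn k u * gsn k v - (u * v - k * (u ^+ 3 * v + u * v ^+ 3) / 6).
have -> : (gmd k u + gmd k v - k * gmd k u * gmd k v - gmd k d - gsn k u * gsn k v * c)
   - (e / 2 - k / 6 * (u ^+ 2 * v ^+ 2 * (1 - c ^+ 2)) - k / 24 * e * (q + d ^+ 2))
   = A + B - k * E - D - S * c.
  by rewrite /A /B /D /E /S eE qE; field.
have pw n x : 0 <= x -> x <= r -> x ^+ n <= r ^+ n.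
  by move=> x0 xr; rewrite lerXn2r ?nnegrE.
have pw2 m n : u ^+ m * v ^+ n <= r ^+ (m + n).
  by rewrite exprD ler_pM ?exprn_ge0 ?pw.
have hA : `|A| <= M * r ^+ 6 by apply: le_trans mu6 _; rewrite ler_pM2l ?pw.
have hB : `|B| <= M * r ^+ 6 by apply: le_trans mv6 _; rewrite ler_pM2l ?pw.
have hD : `|D| <= 64 * M * r ^+ 6.
  apply: le_trans md6 _; have -> : 64 * M * r ^+ 6 = M * (2 * r) ^+ 6 by ring.
  by rewrite ler_pM2l // lerXn2r ?nnegrE //; clear - r0; lra.
have hE : `|E| <= (M * M + M) * r ^+ 6.
  have -> : E = gmd k u * (gmd k v - v ^+ 2 / 2) + (gmd k u - u ^+ 2 / 2) * (v ^+ 2 / 2).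
    by rewrite /E; ring.
  apply: le_trans (ler_normD _ _) _.
  rewrite (normrM (gmd k u)) (normrM _ (v ^+ 2 / 2)) mulrDl; apply: lerD.
    apply: le_trans (_ : M * u ^+ 2 * (M * v ^+ 4) <= _); first by rewrite ler_pM.
    by rewrite mulrACA ler_wpM2l ?(pw2 2%N 4%N) // mulr_ge0 // ltW.
  rewrite (ger0_norm (x := v ^+ 2 / 2)) ?divr_ge0 ?exprn_ge0 //.
  apply: le_trans (_ : M * u ^+ 4 * (v ^+ 2) <= _).
    by rewrite ler_pM ?divr_ge0 ?exprn_ge0 // ler_pdivrMr // ler_peMr ?exprn_ge0 // ler1n.
  by rewrite -mulrA ler_pM2l // (pw2 4%N 2%N).
have hP : `|P v| <= (1 + `|k|) * r.
  apply: le_trans (ler_normB _ _) _; rewrite mulrDl mul1r; apply: lerD.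
    by rewrite ger0_norm.
  rewrite -mulrA normrM ler_wpM2l // ger0_norm ?divr_ge0 ?exprn_ge0 //.
  have v1 : v <= 1 by clear - vr r1; lra.
  have v2 : v ^+ 2 <= 1 by rewrite expr_le1.
  by rewrite exprS; clear - v0 v1 v2 vr; nra.
have hS : `|S| <= (M * M + (1 + `|k|) * M + `|k| ^+ 2) * r ^+ 6.
  have -> : S = gsn k u * (gsn k v - P v) + (gsn k u - P u) * P v
      + k ^+ 2 * (u ^+ 3 * v ^+ 3 / 36).
    by rewrite /S /P; field.
  apply: le_trans (ler_normD _ _) _; rewrite [leRHS]mulrDl; apply: lerD.
    apply: le_trans (ler_normD _ _) _; rewrite [leRHS]mulrDl !normrM; apply: lerD.
      apply: le_trans (_ : M * u * (M * v ^+ 5) <= _); first by rewrite ler_pM.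
      by rewrite mulrACA ler_wpM2l ?(pw2 1%N 5%N) // mulr_ge0 // ltW.
    apply: le_trans (_ : M * u ^+ 5 * ((1 + `|k|) * r) <= _); first by rewrite ler_pM.
    have -> : (1 + `|k|) * M * r ^+ 6 = M * r ^+ 5 * ((1 + `|k|) * r) by ring.
    have k0 := normr_ge0 k.
    by rewrite ler_wpM2r ?mulr_ge0 ?addr_ge0 // ler_pM2l // pw.
  rewrite normrM normrX ler_wpM2l ?exprn_ge0 //.
  rewrite ger0_norm ?divr_ge0 ?mulr_ge0 ?exprn_ge0 //.
  apply: le_trans (pw2 3%N 3%N).
  by rewrite ler_pdivrMr // ler_peMr ?mulr_ge0 ?exprn_ge0 // ler1n.
have hkE : `|k * E| <= `|k| * ((M * M + M) * r ^+ 6).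
  by rewrite normrM ler_wpM2l.
have hSc : `|S * c| <= (M * M + (1 + `|k|) * M + `|k| ^+ 2) * r ^+ 6.
  by apply: le_trans hS; rewrite normrM ler_piMr.
apply: le_trans (ler_normB _ _) _.
apply: le_trans (lerD (ler_normB _ _) (lexx _)) _.
apply: le_trans (lerD (lerD (ler_normB _ _) (lexx _)) (lexx _)) _.
apply: le_trans (lerD (lerD (lerD (ler_normD _ _) (lexx _)) (lexx _)) (lexx _)) _.
apply: le_trans (lerD (lerD (lerD (lerD hA hB) hkE) hD) hSc) _.
by rewrite le_eqVlt; apply/orP; left; apply/eqP; ring.
Qed.

End Expansion.

(** * Small hinges *)

Section Asymptotics.
Context {R : realType}.
Implicit Types (k u v d c q e r C : R).

Lemma law_of_cosines_ge0 u v c : `|c| <= 1 -> 0 <= u -> 0 <= v ->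
  0 <= u ^+ 2 + v ^+ 2 - 2 * u * v * c.
Proof.
rewrite ler_norml => /andP[cN cP] u0 v0.
have uv0 : 0 <= u * v by exact: mulr_ge0.
by have := sqr_ge0 (u - v); rewrite sqrrB -mulr_natl; nra.
Qed.

Lemma gsn_gt0_near k : exists2 r0 : R, 0 < r0 & forall x, 0 < x -> x < r0 -> 0 < gsn k x.
Proof.
exists (pi / (Num.sqrt k + 1)).
  by rewrite divr_gt0 ?pi_gt0 // ltr_wpDl // sqrtr_ge0.
move=> x x0; rewrite ltr_pdivlMr; last by rewrite ltr_wpDl // sqrtr_ge0.
by move=> h; apply: gsn_gt0 => // _; move: h; rewrite mulrDr mulr1 mulrC; lra.
Qed.

(** To leading order a small model triangle is Euclidean. *)
Lemma model_cos_euclid k : exists M r0 : R, [/\ 0 < M, 0 < r0 &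
  forall r u v d, r < r0 -> 0 < u <= r -> 0 < v <= r -> 0 <= d <= u + v ->
  `|model_cos k d u v| <= 1 ->
  `|d ^+ 2 - (u ^+ 2 + v ^+ 2 - 2 * u * v * model_cos k d u v)| <= M * r ^+ 4].
Proof.
have [M M0 HM] := law_of_cosines_expansion k.
have [r1 r10 Hs] := gsn_gt0_near k.
have k0 := normr_ge0 k.
exists (4 * (`|k| + M)), (Num.min r1 (1 / (2 * (1 + `|k|)))).
have k1 : 0 < 1 + `|k| by lra.
split; [lra | by rewrite lt_min r10 divr_gt0 // mulr_gt0 |].
move=> r u v d; rewrite lt_min ltr_pdivlMr ?mulr_gt0 // => /andP[rr1 rk].
move=> /andP[u0 ur] /andP[v0 vr] /andP[d0 duv]; set c := model_cos k d u v => c1.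
have r0 : 0 < r := lt_le_trans u0 ur.
have dr : d <= 2 * r by lra.
have r2 : 2 * r <= 1 by nra.
have kr : `|k| * r ^+ 2 <= 1 / 4 by rewrite expr2; nra.
have ur' : 0 <= u <= r by rewrite ltW.
have vr' : 0 <= v <= r by rewrite ltW.
have dr' : 0 <= d <= 2 * r by rewrite d0.
have := HM r u v d c ur' vr' dr' r2 c1 _ _ erefl erefl.
have su : 0 < gsn k u by apply: Hs => //; exact: le_lt_trans rr1.
have sv : 0 < gsn k v by apply: Hs => //; exact: le_lt_trans rr1.
have -> : gmd k u + gmd k v - k * gmd k u * gmd k v - gmd k d -
    gsn k u * gsn k v * c = 0.
  by rewrite /c /model_cos; field; rewrite !gt_eqF.
set q := u ^+ 2 + v ^+ 2 - 2 * u * v * c.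
rewrite sub0r normrN [`|d ^+ 2 - q|]distrC.
set e := q - d ^+ 2 => h.
move: (c1); rewrite ler_norml => /andP[cN cP].
have uvr : u * v <= r ^+ 2 by rewrite expr2 ler_pM // ltW.
have uv0 : 0 < u * v by exact: mulr_gt0.
have u2 : u ^+ 2 <= r ^+ 2 by rewrite lerXn2r ?nnegrE // ltW.
have v2 : v ^+ 2 <= r ^+ 2 by rewrite lerXn2r ?nnegrE // ltW.
have d2 : d ^+ 2 <= 4 * r ^+ 2 by rewrite !expr2; nra.
have d20 : 0 <= d ^+ 2 by exact: sqr_ge0.
have q0 : 0 <= q by apply: law_of_cosines_ge0 => //; exact: ltW.
have qr : q <= 4 * r ^+ 2 by rewrite /q; clear - uvr uv0 u2 v2 cN; nra.
have h1 : `|k / 24 * e * (q + d ^+ 2)| <= `|e| / 4.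
  rewrite !normrM (ger0_norm (addr_ge0 q0 d20)).
  rewrite (ger0_norm (x := 24^-1)) ?invr_ge0 //.
  have e0 := normr_ge0 e.
  have h8 : `|k| * (q + d ^+ 2) <= 2.
    apply: le_trans (_ : `|k| * (8 * r ^+ 2) <= _); last by clear - kr; lra.
    by rewrite ler_wpM2l //; clear - qr d2; lra.
  have -> : `|k| / 24 * `|e| * (q + d ^+ 2) = `|e| * (`|k| * (q + d ^+ 2) / 24).
    by ring.
  by rewrite ler_wpM2l //; clear - h8; lra.
have h2 : `|k / 6 * (u ^+ 2 * v ^+ 2 * (1 - c ^+ 2))| <= `|k| * r ^+ 4.
  rewrite normrM normrM (ger0_norm (x := 6^-1)) ?invr_ge0 // -mulrA ler_wpM2l //.
  have c2 : 0 <= 1 - c ^+ 2 <= 1 by rewrite expr2; clear - cN cP; nra.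
  rewrite ger0_norm; last first.
    by case/andP: c2 => ? _; rewrite mulr_ge0 // mulr_ge0 // sqr_ge0.
  have r40 : 0 <= r ^+ 4 by rewrite exprn_ge0 // ltW.
  have uv4 : u ^+ 2 * v ^+ 2 <= r ^+ 4.
    by rewrite (_ : 4%N = (2 + 2)%N) // exprD ler_pM ?sqr_ge0.
  have uv40 : 0 <= u ^+ 2 * v ^+ 2 by rewrite mulr_ge0 ?sqr_ge0.
  by clear - c2 r40 uv4 uv40; case/andP: c2; nra.
have r6 : M * r ^+ 6 <= M * r ^+ 4.
  by rewrite ler_pM2l // ler_wiXn2l //; clear - r0 r2; lra.
have he : `|e / 2| <= `|e| / 4 + (`|k| * r ^+ 4 + M * r ^+ 4).
  move: h h1 h2 r6; clear; rewrite !ler_norml => /andP[? ?] /andP[? ?] /andP[? ?] ?.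
  by apply/andP; split; lra.
rewrite normrM (ger0_norm (x := 2^-1)) ?invr_ge0 // in he.
by clear - he; lra.
Qed.

(** The quotient [K] that measures how far the third side [d] of a small hinge
    with legs [u] and [v] and cosine [c] is from its Euclidean value lies
    asymptotically above [k] when [c] is at most the cosine of the model angle,
    and below [k] when it is at least that.  Here [r] is the scale of the hinge
    and [C] bounds the disproportion of its legs. *)
Lemma normalized_defect_bounds k c C eps : c ^+ 2 < 1 -> 0 < eps ->
  exists2 r0 : R, 0 < r0 & forall r u v d, r < r0 ->
  0 < u <= r -> 0 < v <= r -> 0 <= d <= u + v -> r ^+ 2 <= C * (u * v) ->
  let K := 3 * ((u ^+ 2 + v ^+ 2 - 2 * u * v * c - d ^+ 2) /
                (u ^+ 2 * v ^+ 2 * (1 - c ^+ 2))) in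
  (c <= model_cos k d u v -> k - eps <= K) /\
  (model_cos k d u v <= c -> K <= k + eps).
Proof.
move=> c1 eps0.
have [M M0 HM] := law_of_cosines_expansion k.
have [r1 r10 Hs] := gsn_gt0_near k.
have k0 := normr_ge0 k.
have c2 : 0 < 1 - c ^+ 2 by rewrite subr_gt0.
pose N := 6 * M * (C ^+ 2 / (1 - c ^+ 2)).
have N0 : 0 <= N.
  by apply: mulr_ge0; [lra | apply: divr_ge0; [exact: sqr_ge0 | exact: ltW]].
pose L := N + (`|k| + eps) * `|k| + `|k| + 1.
have ke0 : 0 <= (`|k| + eps) * `|k| by rewrite mulr_ge0 // addr_ge0 // ltW.
have L0 : 1 <= L by rewrite /L; clear - N0 k0 ke0; lra.
exists (Num.min r1 (Num.min (1 / 2) (Num.min 1 eps / (2 * L)))).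
  by rewrite !lt_min r10 !divr_gt0 ?lt_min ?ltr01 ?eps0 //; lra.
move=> r u v d; rewrite !lt_min [r < Num.min _ _ / _]ltr_pdivlMr; last lra.
rewrite lt_min => /and3P[rr1 rh /andP[rL1 rLe]].
move=> /andP[u0 ur] /andP[v0 vr] /andP[d0 duv] rC.
set q := u ^+ 2 + v ^+ 2 - 2 * u * v * c.
set D := u ^+ 2 * v ^+ 2 * (1 - c ^+ 2) => K.
have r0 : 0 < r := lt_le_trans u0 ur.
have r2 : 2 * r <= 1 by lra.
have ur' : 0 <= u <= r by rewrite ltW.
have vr' : 0 <= v <= r by rewrite ltW.
have dr' : 0 <= d <= 2 * r by rewrite d0 /=; lra.
have cP : `|c| <= 1.
  by rewrite -(@ler_pXn2r _ 2) ?nnegrE // expr1n real_normK ?num_real // ltW.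
have := HM r u v d c ur' vr' dr' r2 cP q (q - d ^+ 2) erefl erefl.
have su : 0 < gsn k u by apply: Hs => //; exact: le_lt_trans rr1.
have sv : 0 < gsn k v by apply: Hs => //; exact: le_lt_trans rr1.
have suv : 0 < gsn k u * gsn k v by rewrite mulr_gt0.
have -> : gmd k u + gmd k v - k * gmd k u * gmd k v - gmd k d -
    gsn k u * gsn k v * c = gsn k u * gsn k v * (model_cos k d u v - c).
  by rewrite /model_cos; field; rewrite !gt_eqF.
set G := model_cos k d u v - c.
have D0 : 0 < D by rewrite !mulr_gt0 // exprn_gt0.
have eD : q - d ^+ 2 = D * K / 3 by rewrite /K; field; rewrite gt_eqF.
rewrite -/D eD.
have uvr : u * v <= r ^+ 2 by rewrite expr2 ler_pM // ltW.
have uv0 : 0 < u * v by exact: mulr_gt0.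
have u2 : u ^+ 2 <= r ^+ 2 by rewrite lerXn2r ?nnegrE // ltW.
have v2 : v ^+ 2 <= r ^+ 2 by rewrite lerXn2r ?nnegrE // ltW.
have d2 : d ^+ 2 <= 4 * r ^+ 2 by rewrite !expr2; nra.
have d20 : 0 <= d ^+ 2 by exact: sqr_ge0.
move: (cP); rewrite ler_norml => /andP[cN cP1].
have q0 : 0 <= q by apply: law_of_cosines_ge0 => //; exact: ltW.
have qr : q <= 4 * r ^+ 2 by rewrite /q; clear - uvr uv0 u2 v2 cN; nra.
(* The remainder of order six is negligible against [D], of order four. *)
have MD : 6 * (M * r ^+ 6) <= N * r ^+ 2 * D.
  have -> : N * r ^+ 2 * D = 6 * (M * (r ^+ 2 * (C * (u * v)) ^+ 2)).
    by rewrite /N /D; field; rewrite gt_eqF.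
  rewrite !ler_pM2l // (_ : r ^+ 6 = r ^+ 2 * (r ^+ 2) ^+ 2); last by ring.
  rewrite ler_wpM2l ?sqr_ge0 // lerXn2r ?nnegrE ?sqr_ge0 //.
  by apply: le_trans rC; exact: sqr_ge0.
(* [m] is the factor of [K] in the expansion of the law of cosines; it tends to
   1 with the scale. *)
pose m := 1 - k * (q + d ^+ 2) / 12.
have r20 : 0 <= r ^+ 2 by exact: sqr_ge0.
have mk : `|m - 1| <= `|k| * r ^+ 2.
  have -> : m - 1 = - (k * ((q + d ^+ 2) / 12)) by rewrite /m; ring.
  rewrite normrN normrM ler_wpM2l // ger0_norm; first by clear - qr d2 r20; lra.
  by rewrite divr_ge0 // (addr_ge0 q0 d20).
have hL : r ^+ 2 * L < 1 / 2 by move: rL1; rewrite -(ltr_pM2l r0) expr2; clear - r2; lra.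
have heps : r ^+ 2 * L < eps.
  have h : r * (2 * L) * r <= r * (2 * L) * 1.
    by rewrite ler_wpM2l //; clear - r0 L0 r2; nra.
  by clear - h rLe eps0; rewrite expr2; lra.
set Y := (X in `|X| <= _) => h.
have key : `|6 * (gsn k u * gsn k v * G) - D * (K * m - k)| <= D * (N * r ^+ 2).
  have -> : 6 * (gsn k u * gsn k v * G) - D * (K * m - k) = 6 * Y.
    by rewrite /Y /m; field.
  rewrite normrM (ger0_norm (x := 6)) // [leRHS]mulrC; apply: le_trans MD.
  by rewrite ler_pM2l.
have m0 : 0 < m.
  have : `|k| * r ^+ 2 <= 1 / 2.
    apply: le_trans (ltW hL); rewrite mulrC ler_wpM2l // /L.
    by clear - ke0 N0 k0; lra.
  by clear - mk; rewrite ler_norml in mk; case/andP: mk; lra.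
have small : r ^+ 2 * (N + (`|k| + eps) * `|k|) < eps.
  by apply: le_lt_trans heps; rewrite ler_wpM2l // /L; clear - k0; lra.
have drift s : `|s| = eps -> `|(k + s) * (m - 1)| <= r ^+ 2 * ((`|k| + eps) * `|k|).
  move=> se; rewrite normrM mulrCA ler_pM //.
    by apply: le_trans (ler_normD _ _) _; rewrite se.
  by rewrite mulrC.
move: key; rewrite ler_norml => /andP[kN kP]; split => hc.
- have KN : k - N * r ^+ 2 <= K * m.
    have : 0 <= 6 * (gsn k u * gsn k v * G).
      by rewrite mulr_ge0 // (mulr_ge0 (ltW suv)) // subr_ge0.
    move=> G0; have : 0 <= D * (K * m - k + N * r ^+ 2) by clear - G0 kP; lra.
    by rewrite pmulr_rge0 //; clear; lra.
  rewrite leNgt; apply/negP => Kk.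
  have := drift (- eps); rewrite normrN gtr0_norm // => /(_ erefl).
  rewrite ler_norml => /andP[_ hd].
  have : K * m < (k - eps) * m by rewrite ltr_pM2r.
  by clear - KN hd small; lra.
- have KN : K * m <= k + N * r ^+ 2.
    have : 6 * (gsn k u * gsn k v * G) <= 0.
      by rewrite pmulr_rle0 // pmulr_rle0 // subr_le0.
    move=> G0; have : D * (K * m - k - N * r ^+ 2) <= 0 by clear - G0 kN; lra.
    by rewrite pmulr_rle0 //; clear; lra.
  rewrite leNgt; apply/negP => Kk.
  have := drift eps; rewrite gtr0_norm // => /(_ erefl).
  rewrite ler_norml => /andP[hd _].
  have : (k + eps) * m < K * m by rewrite ltr_pM2r.
  by clear - KN hd small; lra.
Qed.

End Asymptotics.

(** * Limits *)

Section Limits.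
Context {R : realType}.

Lemma limf_esup_le {T : choiceType} {X : filteredType T} (f : X -> R)
    (F : set_system X) (V : set X) (m : R) :
  F V -> (forall x, V x -> f x <= m) ->
  (limf_esup (fun x => (f x)%:E) F <= m%:E)%E.
Proof.
move=> FV fm; rewrite limf_esupE; apply: ge_ereal_inf.
exists (ereal_sup [set (f x)%:E | x in V]); first by exists V.
by apply: ge_ereal_sup => _ [x Vx <-]; rewrite lee_fin fm.
Qed.

Lemma limf_esup_ge {T : choiceType} {X : filteredType T} (f : X -> R)
    (F : set_system X) (m : R) :
  (forall V, F V -> exists2 x, V x & m <= f x) ->
  (m%:E <= limf_esup (fun x => (f x)%:E) F)%E.
Proof.
move=> fm; rewrite limf_esupE; apply: le_ereal_inf_tmp => _ [V FV <-].
have [x Vx mfx] := fm V FV.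
apply: (@le_trans _ _ (f x)%:E); first by rewrite lee_fin.
by apply: ereal_sup_ubound; exists x.
Qed.

Lemma limf_esup_cvg {T : choiceType} {X : filteredType T} (f : X -> R)
    (F : set_system X) {FF : ProperFilter F} (l : R) :
  (forall eps : R, 0 < eps -> \forall x \near F, `|f x - l| <= eps) ->
  limf_esup (fun x => (f x)%:E) F = l%:E.
Proof.
move=> fl; apply/eqP; rewrite eq_le; apply/andP; split.
  apply/lee_addgt0Pr => e e0; rewrite -EFinD.
  apply: limf_esup_le (fl e e0) _ => x; rewrite ler_distl; lra.
apply/lee_subgt0Pr => e e0; rewrite -EFinB.
apply: limf_esup_ge => V FV.
have [x [Vx +]] := filter_ex (filterI FV (fl e e0)).
by rewrite ler_distl => /andP[? ?]; exists x.
Qed.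

Lemma le_limn_einf (u : R^nat) (m : R) :
  (forall eps, 0 < eps -> \forall n \near \oo, m - eps <= u n) ->
  (m%:E <= limn_einf (fun n => (u n)%:E))%E.
Proof.
move=> mu; rewrite /limn_einf leeNr; apply/lee_addgt0Pr => e e0.
have -> : (\- (fun n => (u n)%:E))%E = (fun n => (- u n)%:E) by [].
apply: limf_esup_le (mu e e0) _ => n /=; lra.
Qed.

Lemma limn_esup_le (u : R^nat) (m : R) :
  (forall eps, 0 < eps -> \forall n \near \oo, u n <= m + eps) ->
  (limn_esup (fun n => (u n)%:E) <= m%:E)%E.
Proof.
move=> mu; apply/lee_addgt0Pr => e e0; rewrite -EFinD.
exact: limf_esup_le (mu e e0) _.
Qed.

(** A bounded function of two variables, nondecreasing in each of them, has a
    limit at the origin of the quadrant, namely its infimum. *)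
Lemma monotone_corner_limit (f : R -> R -> R) (delta : R) : 0 < delta ->
  (forall s t, 0 < s < delta -> 0 < t < delta -> `|f s t| <= 1) ->
  (forall s' s t, 0 < s' -> s' <= s -> s < delta -> 0 < t < delta ->
    f s' t <= f s t) ->
  (forall s t' t, 0 < t' -> t' <= t -> t < delta -> 0 < s < delta ->
    f s t' <= f s t) ->
  exists c, [/\ `|c| <= 1,
    forall s t, 0 < s < delta -> 0 < t < delta -> c <= f s t &
    forall eps, 0 < eps -> exists2 eta, 0 < eta &
      forall s t, 0 < s < eta -> 0 < t < eta -> `|f s t - c| <= eps].
Proof.
move=> d0 f1 fs ft.
pose A := [set y : R | exists s t, [/\ 0 < s < delta, 0 < t < delta & y = f s t]].
have d2 : 0 < delta / 2 < delta by apply/andP; split; lra.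
have Af : A (f (delta / 2) (delta / 2)) by exists (delta / 2), (delta / 2).
have lbA : lbound A (-1).
  by move=> _ [s [t [hs ht ->]]]; have := f1 s t hs ht; rewrite ler_norml => /andP[].
have infA : has_inf A by split; [exists (f (delta / 2) (delta / 2)) | exists (-1)].
have cf s t : 0 < s < delta -> 0 < t < delta -> inf A <= f s t.
  by move=> hs ht; apply: ge_inf; [exact: infA.2 | exists s, t].
exists (inf A); split => //.
  rewrite ler_norml; apply/andP; split; first by apply: lb_le_inf => //; exact: infA.1.
  apply: le_trans (cf _ _ d2 d2) _.
  by have := f1 _ _ d2 d2; rewrite ler_norml => /andP[].
move=> e e0; have [_ [s [t [/andP[s0 sd] /andP[t0 td] ->]]] fe] := inf_adherent e0 infA.
exists (Num.min s t); first by rewrite lt_min s0.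
move=> s' t' /andP[s'0]; rewrite lt_min => /andP[s's s't] /andP[t'0].
rewrite lt_min => /andP[t's t't].
have hs' : 0 < s' < delta by rewrite s'0 (lt_trans s's).
have ht' : 0 < t' < delta by rewrite t'0 (lt_trans t't).
have h0 := cf s' t' hs' ht'.
have h1 : f s' t' <= f s t' by apply: fs => //; exact: ltW.
have h2 : f s t' <= f s t by apply: ft; rewrite ?s0 //; exact: ltW.
by rewrite ler_norml; apply/andP; split; lra.
Qed.

End Limits.

(** * Hinges spanned by two geodesics *)

Section Hinges.
Context {R : realType} {X : metricType R}.
Implicit Types (z : X) (U : set X) (k : R).

Lemma geodesic_dist0 z (a : geodesic_from z) (s : R) : 0 <= s <= geod_dom a ->
  mdist z (a s) = speed a * s.
Proof.
move=> hs; rewrite -{1}(geod_path0 a) (@geod_pathP _ _ _ a) //.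
  by rewrite sub0r normrN ger0_norm //; case/andP: hs.
by rewrite lexx ltW // geod_dom_gt0.
Qed.

Lemma hinge_ge z (a b : geodesic_from z) (s t : R) :
  0 <= s <= geod_dom a -> 0 <= t <= geod_dom b ->
  `|speed a * s - speed b * t| <= mdist (a s) (b t).
Proof.
move=> hs ht; rewrite -!geodesic_dist0 // ler_distl.
have h1 := metric_triangle z (a s) (b t).
have h2 := metric_triangle z (b t) (a s).
by rewrite [mdist (b t) (a s)]metric_sym in h2; apply/andP; split; lra.
Qed.

Lemma hinge_le z (a b : geodesic_from z) (s t : R) :
  0 <= s <= geod_dom a -> 0 <= t <= geod_dom b ->
  mdist (a s) (b t) <= speed a * s + speed b * t.
Proof.
move=> hs ht; rewrite -!geodesic_dist0 //.
by apply: le_trans (metric_triangle _ z _) _; rewrite [mdist (a s) z]metric_sym.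
Qed.

(** The cosine of the angle at [z] of the comparison triangle of curvature [k]
    for the hinge with endpoints [a s] and [b t]. *)
Definition hinge_cos k z (a b : geodesic_from z) (s t : R) : R :=
  model_cos k (mdist (a s) (b t)) (speed a * s) (speed b * t).

Lemma hinge_cosC k z (a b : geodesic_from z) (s t : R) :
  hinge_cos k a b s t = hinge_cos k b a t s.
Proof. by rewrite /hinge_cos model_cosC metric_sym. Qed.

(** A lower curvature bound makes the cosine of the comparison angle nondecreasing
    in the length of a leg, an upper bound makes it nonincreasing: this is the
    triangle comparison for the triangle [(b t, z, a s)] and the point [a s'] of
    its side [(z, a s)]. *)
Lemma hinge_cos_monotone z (a b : geodesic_from z) U k (eps s' s t : R) :
  geodesic_space X -> (forall x, mdist z x < eps -> U x) ->
  0 < speed a -> 0 < speed b ->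
  0 < s' -> s' <= s -> s <= geod_dom a -> 0 < t <= geod_dom b ->
  2 * (speed a * s) + speed b * t < eps ->
  (0 < k -> Num.sqrt k * (speed a * s + speed b * t) < pi) ->
  (curvature_ge_on U k -> hinge_cos k a b s' t <= hinge_cos k a b s t) /\
  (curvature_le_on U k -> hinge_cos k a b s t <= hinge_cos k a b s' t).
Proof.
move=> hX Ueps va vb s'0 s's sa /andP[t0 tb] eps_st kst.
have s0 : 0 < s := lt_le_trans s'0 s's.
have hs : 0 <= s <= geod_dom a by rewrite ltW.
have hs' : 0 <= s' <= geod_dom a by rewrite ltW //= (le_trans s's).
have ht : 0 <= t <= geod_dom b by rewrite ltW.
have u0 : 0 < speed a * s by exact: mulr_gt0.
have u10 : 0 < speed a * s' by exact: mulr_gt0.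
have u1u : speed a * s' <= speed a * s by rewrite ler_pM2l.
have v0 : 0 < speed b * t by exact: mulr_gt0.
have dge := hinge_ge hs ht; have dle := hinge_le hs ht.
have [p' [x' [y' [w' [[sp sx sy sw] [[dpx dxy dyp dxw dwy] [r [dpw /andP[r0 ru] mr]]]]]]]] :=
  model_hinge (ltW u10) u1u u0 v0 kst dge dle.
(* The side opposite to [z] is an arbitrary geodesic; it stays in the ball of
   radius [eps] because its length is at most the sum of the two legs. *)
have [g [g0 g1 gg]] := hX (a s) (b t).
have d0 : 0 <= mdist (a s) (b t) := mdist_ge0 _ _.
have tri : geodesic_triangle U (b t) z (a s)
    (fun tau => b (t * (1 - tau))) (fun tau => a (s * tau)) g.
  split; last 1 first.
  - move=> tau /andP[tau0 tau1].
    have h1 : 0 <= t * (1 - tau) <= geod_dom b by apply/andP; split; nra.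
    have h2 : 0 <= s * tau <= geod_dom a by apply/andP; split; nra.
    split; apply: Ueps.
    + by rewrite geodesic_dist0 //; nra.
    + by rewrite geodesic_dist0 //; nra.
    + apply: le_lt_trans (metric_triangle _ (a s) _) _.
      rewrite geodesic_dist0 // -{1}g0 gg ?lexx ?ler01 ?tau0 //.
      by rewrite sub0r normrN ger0_norm //; nra.
  - split; rewrite ?subr0 ?mulr1 ?subrr ?mulr0 ?geod_path0 //.
    move=> x y /andP[x0 x1] /andP[y0 y1]; rewrite (@geod_pathP _ _ _ b); first last.
    + by apply/andP; split; nra.
    + by apply/andP; split; nra.
    rewrite -mulrBr normrM gtr0_norm // mulrA [mdist _ z]metric_sym geodesic_dist0 //.
    by rewrite distrC; congr (_ * `|_|); ring.
  - split; rewrite ?mulr1 ?mulr0 ?geod_path0 //.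
    move=> x y /andP[x0 x1] /andP[y0 y1]; rewrite (@geod_pathP _ _ _ a); first last.
    + by apply/andP; split; nra.
    + by apply/andP; split; nra.
    by rewrite -mulrBr normrM gtr0_norm // mulrA geodesic_dist0.
  - by split.
have per : small_perimeter k (b t) z (a s).
  move=> k0; rewrite ltr_pdivlMr ?sqrtr_gt0 //.
  rewrite [mdist (b t) z]metric_sym !geodesic_dist0 //.
  have q0 : 0 < Num.sqrt k by rewrite sqrtr_gt0.
  by have := kst k0; nra.
have cmp : comparison_triangle k (b t) z (a s) p' x' y'.
  split; split => //; first by rewrite dpx metric_sym geodesic_dist0.
  by rewrite dxy geodesic_dist0.
have tau01 : 0 <= s' / s <= 1 by rewrite (divr_ge0 (ltW s'0) (ltW s0)) /= ler_pdivrMr // mul1r.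
have tauE : s * (s' / s) = s' by rewrite mulrC divfK // gt_eqF.
have cpt : comparison_point k z (a s) (a (s * (s' / s))) x' y' w'.
  rewrite tauE; split => //; first by rewrite dxw geodesic_dist0.
  by rewrite dwy (@geod_pathP _ _ _ a) // distrC ger0_norm ?subr_ge0 // mulrBr.
have su v : 0 < v -> v <= speed a * s + speed b * t -> 0 < gsn k v.
  move=> v_gt0 vuv; apply: gsn_gt0 => // k0; apply: le_lt_trans (kst k0).
  by rewrite ler_pM2l // sqrtr_gt0.
have su1 : 0 < gsn k (speed a * s') by apply: su => //; lra.
have sv : 0 < gsn k (speed b * t) by apply: su => //; lra.
have kle v : v <= speed a * s' + speed b * t -> 0 < k -> Num.sqrt k * v <= pi.
  move=> vuv k0; apply/ltW/(le_lt_trans _ (kst k0)).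
  by rewrite ler_pM2l ?sqrtr_gt0 //; lra.
have D0 := mdist_ge0 (a s') (b t); have Dle := hinge_le hs' ht.
have suv : 0 < gsn k (speed a * s') * gsn k (speed b * t) by exact: mulr_gt0.
split => curv.
- have := curv _ _ _ _ _ _ tri per _ _ _ cmp _ _ tau01 cpt.
  rewrite /= tauE dpw [mdist (b t) _]metric_sym => /(gmd_le (kle _ Dle) r0).
  rewrite mr {1}/hinge_cos {2}/model_cos ler_pdivrMr // -/(hinge_cos k a b s t); lra.
- have := curv _ _ _ _ _ _ tri per _ _ _ cmp _ _ tau01 cpt.
  rewrite /= tauE dpw [mdist (b t) _]metric_sym => /(gmd_le (kle _ ru) D0).
  rewrite mr {2}/hinge_cos {2}/model_cos ler_pdivlMr // -/(hinge_cos k a b s t); lra.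
Qed.

End Hinges.

(** * The angle between two geodesics *)

Section Angles.
Context {R : realType} {X : metricType R}.
Implicit Types (z : X) (k c : R).

(** The scale below which the hinges spanned by two geodesics are covered by a
    curvature bound on the ball of radius [eps] around their origin. *)
Lemma hinge_scale z (a b : geodesic_from z) k (eps : R) : 0 < eps ->
  0 < speed a -> 0 < speed b ->
  exists delta, [/\ 0 < delta, delta <= geod_dom a, delta <= geod_dom b &
  forall s t, 0 < s < delta -> 0 < t < delta ->
    2 * (speed a * s + speed b * t) < eps /\
    (0 < k -> Num.sqrt k * (speed a * s + speed b * t) < pi)].
Proof.
move=> e0 va vb; pose W := speed a + speed b; have W0 : 0 < W by exact: addr_gt0.
have q0 := sqrtr_ge0 k; have q1 : 0 < Num.sqrt k + 1 by lra.
exists (Num.min (Num.min (geod_dom a) (geod_dom b))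
  (Num.min (eps / (2 * W)) (pi / ((Num.sqrt k + 1) * W)))).
split.
- by rewrite !lt_min !geod_dom_gt0 !divr_gt0 ?pi_gt0 ?mulr_gt0.
- by rewrite !ge_min lexx.
- by rewrite !ge_min lexx orbT.
move=> s t /andP[s0]; rewrite !lt_min => /andP[_ /andP[s1 s2]].
move=> /andP[t0] /andP[_ /andP[t1 t2]].
rewrite ltr_pdivlMr ?mulr_gt0 // in s1; rewrite ltr_pdivlMr ?mulr_gt0 // in s2.
rewrite ltr_pdivlMr ?mulr_gt0 // in t1; rewrite ltr_pdivlMr ?mulr_gt0 // in t2.
pose m := Num.max s t.
have sm : s <= m by rewrite le_max lexx.
have tm : t <= m by rewrite le_max lexx orbT.
have m1 : m * (2 * W) < eps by rewrite /m; case: (leP s t).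
have m2 : m * ((Num.sqrt k + 1) * W) < pi by rewrite /m; case: (leP s t).
have stm : speed a * s + speed b * t <= m * W by rewrite /W; nra.
have st0 : 0 < speed a * s + speed b * t by rewrite addr_gt0 ?mulr_gt0.
split; first lra.
by move=> _; nra.
Qed.

Lemma hinge_cos_bound z (a b : geodesic_from z) k (s t : R) :
  0 < speed a -> 0 < speed b -> 0 < s <= geod_dom a -> 0 < t <= geod_dom b ->
  (0 < k -> Num.sqrt k * (speed a * s + speed b * t) < pi) ->
  `|hinge_cos k a b s t| <= 1.
Proof.
move=> va vb /andP[s0 sa] /andP[t0 tb] kst.
have hs : 0 <= s <= geod_dom a by rewrite ltW.
have ht : 0 <= t <= geod_dom b by rewrite ltW.
apply: model_cos_bound => //; [exact: mulr_gt0|exact: mulr_gt0|exact: hinge_ge|exact: hinge_le].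
Qed.

(** [c] is the cosine of the angle between [a] and [b]: the limit of the
    cosines of the comparison angles of curvature [k]. *)
Definition angle_cosine k z (a b : geodesic_from z) c :=
  `|c| <= 1 /\ forall eps : R, 0 < eps -> exists2 eta, 0 < eta &
    forall s t, 0 < s < eta -> 0 < t < eta -> `|hinge_cos k a b s t - c| <= eps.

(** Under a lower curvature bound the angle exists and the comparison angles of
    small hinges are at most equal to it. *)
Lemma angle_cosine_ge z (a b : geodesic_from z) k :
  geodesic_space X -> curvature_ge_near z k -> 0 < speed a -> 0 < speed b ->
  exists c, angle_cosine k a b c /\ exists2 delta, 0 < delta &
    forall s t, 0 < s < delta -> 0 < t < delta -> c <= hinge_cos k a b s t.
Proof.
move=> hX [U] /nbhs_ballP[eps e0 Ueps] curv va vb.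
have {}Ueps x : mdist z x < eps -> U x by move=> zx; apply: Ueps; rewrite ballEmdist.
have [delta [d0 da db hd]] := hinge_scale k e0 va vb.
have [|||c [c1 cf lim]] := @monotone_corner_limit _ (hinge_cos k a b) delta d0.
- move=> s t hs ht; case: (hd s t hs ht) => _ kst; case/andP: hs => s0 sd; case/andP: ht => t0 td.
  by apply: hinge_cos_bound; rewrite ?s0 ?t0 //= ltW // (lt_le_trans _ da, lt_le_trans _ db).
- move=> s' s t s'0 s's sd ht; have hs : 0 < s < delta by rewrite (lt_le_trans s'0).
  have [e1 kst] := hd s t hs ht; case/andP: (ht) => t0 td.
  have vbt := mulr_gt0 vb t0.
  apply: (hinge_cos_monotone hX Ueps va vb s'0 s's _ _ _ kst).1 => //; last by lra.
    by rewrite (le_trans (ltW sd)).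
  by rewrite t0 (le_trans (ltW td)).
- move=> s t' t t'0 t't td hs; have ht : 0 < t < delta by rewrite (lt_le_trans t'0).
  have [e1 kst] := hd s t hs ht; case/andP: (hs) => s0 sd.
  rewrite addrC in kst; have vas := mulr_gt0 va s0.
  rewrite 2!(hinge_cosC k a).
  apply: (hinge_cos_monotone hX Ueps vb va t'0 t't _ _ _ kst).1 => //; last by lra.
    by rewrite (le_trans (ltW td)).
  by rewrite s0 (le_trans (ltW sd)).
by exists c; split => //; exists delta.
Qed.

(** Under an upper curvature bound the angle exists and the comparison angles of
    small hinges are at least equal to it. *)
Lemma angle_cosine_le z (a b : geodesic_from z) k :
  geodesic_space X -> curvature_le_near z k -> 0 < speed a -> 0 < speed b ->
  exists c, angle_cosine k a b c /\ exists2 delta, 0 < delta &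
    forall s t, 0 < s < delta -> 0 < t < delta -> hinge_cos k a b s t <= c.
Proof.
move=> hX [U] /nbhs_ballP[eps e0 Ueps] curv va vb.
have {}Ueps x : mdist z x < eps -> U x by move=> zx; apply: Ueps; rewrite ballEmdist.
have [delta [d0 da db hd]] := hinge_scale k e0 va vb.
have [|||c [c1 cf lim]] :=
  @monotone_corner_limit _ (fun s t => - hinge_cos k a b s t) delta d0.
- move=> s t hs ht; case: (hd s t hs ht) => _ kst; case/andP: hs => s0 sd; case/andP: ht => t0 td.
  rewrite normrN.
  by apply: hinge_cos_bound; rewrite ?s0 ?t0 //= ltW // (lt_le_trans _ da, lt_le_trans _ db).
- move=> s' s t s'0 s's sd ht; have hs : 0 < s < delta by rewrite (lt_le_trans s'0).
  have [e1 kst] := hd s t hs ht; case/andP: (ht) => t0 td.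
  have vbt := mulr_gt0 vb t0; rewrite lerN2.
  apply: (hinge_cos_monotone hX Ueps va vb s'0 s's _ _ _ kst).2 => //; last by lra.
    by rewrite (le_trans (ltW sd)).
  by rewrite t0 (le_trans (ltW td)).
- move=> s t' t t'0 t't td hs; have ht : 0 < t < delta by rewrite (lt_le_trans t'0).
  have [e1 kst] := hd s t hs ht; case/andP: (hs) => s0 sd.
  rewrite addrC in kst; have vas := mulr_gt0 va s0.
  rewrite 2!(hinge_cosC k a) lerN2.
  apply: (hinge_cos_monotone hX Ueps vb va t'0 t't _ _ _ kst).2 => //; last by lra.
    by rewrite (le_trans (ltW td)).
  by rewrite s0 (le_trans (ltW sd)).
exists (- c); split; last first.
  by exists delta => // s t hs ht; rewrite lerNr; exact: cf.
split; first by rewrite normrN.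
move=> e /lim[eta eta0 heta]; exists eta => // s t hs ht.
by rewrite opprK -normrN opprD; exact: heta.
Qed.

Lemma sqrt_dist_le (x q eps : R) : 0 <= x -> 0 <= q -> 0 <= eps ->
  `|x ^+ 2 - q| <= eps ^+ 2 -> `|x - Num.sqrt q| <= eps.
Proof.
move=> x0 q0 e0 h; rewrite -(@ler_pXn2r _ 2) ?nnegrE //.
apply: le_trans h; rewrite -{2}(sqr_sqrtr q0) subr_sqr normrM expr2.
rewrite ler_wpM2l //.
have y0 := sqrtr_ge0 q; rewrite [leRHS]ger0_norm ?addr_ge0 //.
by rewrite ler_norml; apply/andP; split; lra.
Qed.

Lemma near_right_small (P : R -> Prop) (m : R) : 0 < m ->
  (forall r, 0 < r -> r < m -> P r) -> \forall r \near (0 : R)^'+, P r.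
Proof.
move=> m0 h; near=> r; apply: h.
  by near: r; exact: nbhs_right_gt.
by near: r; exact: nbhs_right_lt.
Unshelve. all: by end_near. Qed.

(** As [r] decreases to 0, the ratio [d(a_{sr}, b_{tr}) / r] converges to the
    third side of the Euclidean hinge with cosine [c]. *)
Lemma ray_distance z (a b : geodesic_from z) k c (s t : R) :
  angle_cosine k a b c -> 0 < speed a -> 0 < speed b -> 0 < s -> 0 < t ->
  forall eps, 0 < eps -> \forall r \near (0 : R)^'+,
  `|r^-1 * mdist (a (s * r)) (b (t * r)) - Num.sqrt ((speed a * s) ^+ 2 +
     (speed b * t) ^+ 2 - 2 * (speed a * s) * (speed b * t) * c)| <= eps.
Proof.
move=> [c1 hc] va vb s0 t0 eps e0.
set u := speed a * s; set v := speed b * t.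
have u0 : 0 < u by exact: mulr_gt0.
have v0 : 0 < v by exact: mulr_gt0.
have [M [r0 [M0 r00 HM]]] := model_cos_euclid k.
have [delta [d0 da db hd]] := hinge_scale k ltr01 va vb.
have uv0 : 0 < u * v by exact: mulr_gt0.
have W0 : 0 < u + v by exact: addr_gt0.
have e20 : 0 < eps ^+ 2 by exact: exprn_gt0.
have [eta eta0 heta] := hc (eps ^+ 2 / (4 * (u * v))) (divr_gt0 e20 (mulr_gt0 (ltr0Sn _ 3) uv0)).
pose N := M * (u + v) ^+ 4.
have N0 : 0 < N by rewrite mulr_gt0 // exprn_gt0.
apply: (@near_right_small _ (Num.min (Num.min 1 (Num.min (r0 / (u + v)) (eps ^+ 2 / (2 * N))))
   (Num.min (Num.min delta eta / s) (Num.min delta eta / t)))).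
  by rewrite !lt_min ltr01 !divr_gt0 ?lt_min ?d0 ?eta0 // mulr_gt0.
move=> r rpos; rewrite !lt_min !ltr_pdivlMr ?mulr_gt0 // !lt_min.
move=> /andP[/and3P[r1 rr0 re] /andP[/andP[sd se] /andP[td te]]].
rewrite mulrC in sd; rewrite mulrC in se; rewrite mulrC in td; rewrite mulrC in te.
have sr0 : 0 < s * r by exact: mulr_gt0.
have tr0 : 0 < t * r by exact: mulr_gt0.
have hsd : 0 < s * r < delta by rewrite sr0.
have htd : 0 < t * r < delta by rewrite tr0.
have [_ kst] := hd _ _ hsd htd.
have hsr : 0 < s * r <= geod_dom a by rewrite sr0 (le_trans (ltW sd)).
have htr : 0 < t * r <= geod_dom b by rewrite tr0 (le_trans (ltW td)).
have hsr' : 0 <= s * r <= geod_dom a by rewrite ltW //=; case/andP: hsr.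
have htr' : 0 <= t * r <= geod_dom b by rewrite ltW //=; case/andP: htr.
have A1 := hinge_cos_bound va vb hsr htr kst.
have ru : speed a * (s * r) = r * u by rewrite /u; ring.
have rv : speed b * (t * r) = r * v by rewrite /v; ring.
have hu : 0 < r * u <= r * (u + v) by rewrite mulr_gt0 //= ler_pM2l // lerDl ltW.
have hv : 0 < r * v <= r * (u + v) by rewrite mulr_gt0 //= ler_pM2l // lerDr ltW.
have hdist : 0 <= mdist (a (s * r)) (b (t * r)) <= r * u + r * v.
  by rewrite mdist_ge0 -ru -rv hinge_le.
have AE : hinge_cos k a b (s * r) (t * r) =
    model_cos k (mdist (a (s * r)) (b (t * r))) (r * u) (r * v).
  by rewrite /hinge_cos ru rv.
rewrite AE in A1; have := HM _ _ _ _ rr0 hu hv hdist A1; rewrite -AE.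
have := heta (s * r) (t * r); rewrite sr0 tr0 => /(_ se te).
set A := hinge_cos _ _ _ _ _; set d := mdist _ _ => hA h.
apply: sqrt_dist_le; [| |exact: ltW|].
- by rewrite mulr_ge0 ?mdist_ge0 // invr_ge0 ltW.
- by apply: law_of_cosines_ge0 => //; exact: ltW.
have rn0 : r != 0 by rewrite gt_eqF.
have -> : (r^-1 * d) ^+ 2 - (u ^+ 2 + v ^+ 2 - 2 * u * v * c) =
  (d ^+ 2 - ((r * u) ^+ 2 + (r * v) ^+ 2 - 2 * (r * u) * (r * v) * A)) / r ^+ 2
  - 2 * (u * v) * (A - c).
  by field.
(* The first term is the error of the Euclidean approximation, the second one
   the deviation of the comparison angle from its limit. *)
apply: le_trans (ler_normB _ _) _.
rewrite [leRHS](splitr (eps ^+ 2)); apply: lerD.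
  rewrite normrM normfV (ger0_norm (x := r ^+ 2)) ?sqr_ge0 //.
  rewrite ler_pdivrMr ?exprn_gt0 //; apply: le_trans h _.
  have -> : M * (r * (u + v)) ^+ 4 = N * r ^+ 2 * r ^+ 2 by rewrite /N; ring.
  rewrite ler_wpM2r ?sqr_ge0 // expr2.
  have : r * (r * N) <= r * N by rewrite ler_piMl ?mulr_ge0 // ltW.
  lra.
rewrite normrM ger0_norm; last by rewrite mulr_ge0 // ltW.
apply: le_trans (_ : 2 * (u * v) * (eps ^+ 2 / (4 * (u * v))) <= _).
  by rewrite ler_pM2l // mulr_gt0.
by rewrite le_eqVlt; apply/orP; left; apply/eqP; field; rewrite !gt_eqF.
Qed.

End Angles.

(** * Sectional curvature *)

Section SectionalCurvature.
Context {R : realType} {X : metricType R}.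
Implicit Types (z : X) (k c : R).

Lemma dir_dist_rescale z (a b : geodesic_from z) k c (s t : R) :
  angle_cosine k a b c -> 0 < speed a -> 0 < speed b -> 0 < s -> 0 < t ->
  dir_dist (rescale s a) (rescale t b) = Num.sqrt ((speed a * s) ^+ 2 +
     (speed b * t) ^+ 2 - 2 * (speed a * s) * (speed b * t) * c).
Proof.
move=> hc va vb s0 t0.
by rewrite /dir_dist /rescale (limf_esup_cvg (ray_distance hc va vb s0 t0)).
Qed.

Lemma dir_inner_cos z (a b : geodesic_from z) k c :
  angle_cosine k a b c -> 0 < speed a -> 0 < speed b ->
  dir_inner a b = speed a * speed b * c.
Proof.
move=> hc va vb; have := dir_dist_rescale hc va vb ltr01 ltr01.
have E (g : R -> X) : rescale 1 g = g by apply/funext => x; rewrite /rescale mul1r.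
rewrite !E !mulr1 /dir_inner => ->; rewrite sqr_sqrtr; first by field.
by apply: law_of_cosines_ge0; [exact: hc.1 | exact: ltW | exact: ltW].
Qed.

Lemma acos_le (x y : R) : -1 <= x <= 1 -> 0 <= y <= pi -> cos y <= x -> acos x <= y.
Proof.
move=> hx hy; apply: contraTT; rewrite -!ltNge => yx.
rewrite -[ltLHS]acosK ?in_itv // ltr_cos ?in_itv //=.
by rewrite acos_ge0 ?acos_lepi.
Qed.

Lemma acos_ge (x y : R) : -1 <= x <= 1 -> 0 <= y <= pi -> x <= cos y -> y <= acos x.
Proof.
move=> hx hy; apply: contraTT; rewrite -!ltNge => yx.
rewrite -[ltRHS]acosK ?in_itv // ltr_cos ?in_itv //=.
by rewrite acos_ge0 ?acos_lepi.
Qed.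

Lemma near_right_ex (P : set R) : (\forall r \near (0 : R)^'+, P r) ->
  exists2 m : R, 0 < m & forall r, 0 < r -> r < m -> P r.
Proof.
move=> /nbhs_ballP[e /= e0 h]; exists e => // r r0 re; apply: h => //.
by rewrite /ball /= sub0r normrN gtr0_norm.
Qed.

(** The comparison angle is the arccosine of a number in [[-1, 1]], for which the
    Euclidean law of cosines holds. *)
Lemma comparison_angleE z (a b : geodesic_from z) (s t : R) :
  0 < speed a -> 0 < speed b -> 0 < s <= geod_dom a -> 0 < t <= geod_dom b ->
  exists x : R, [/\ comparison_angle z (a s) (b t) = acos x, -1 <= x <= 1 &
    mdist (a s) (b t) ^+ 2 = (speed a * s) ^+ 2 + (speed b * t) ^+ 2 -
      2 * (speed a * s) * (speed b * t) * x].
Proof.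
move=> va vb /andP[s0 sa] /andP[t0 tb].
have hs : 0 <= s <= geod_dom a by rewrite ltW.
have ht : 0 <= t <= geod_dom b by rewrite ltW.
have := hinge_ge hs ht; have := hinge_le hs ht; rewrite /comparison_angle !geodesic_dist0 //.
set u := speed a * s; set v := speed b * t; set d := mdist _ _ => h1 h2.
have d0 : 0 <= d by exact: mdist_ge0.
have u0 : 0 < u by exact: mulr_gt0.
have v0 : 0 < v by exact: mulr_gt0.
have uv0 : 0 < 2 * u * v by rewrite !mulr_gt0.
exists ((u ^+ 2 + v ^+ 2 - d ^+ 2) / (2 * u * v)); split => //.
  have h3 : (u - v) ^+ 2 <= d ^+ 2.
    by rewrite -(real_normK (num_real (u - v))) lerXn2r ?nnegrE.
  have h4 : d ^+ 2 <= (u + v) ^+ 2 by rewrite lerXn2r ?nnegrE // ltW // addr_gt0.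
  move: h3 h4; rewrite sqrrB sqrrD !mulr2n => h3 h4.
  by rewrite ler_pdivlMr ?ler_pdivrMr //; apply/andP; split; lra.
by field; rewrite !gt_eqF.
Qed.

(** If the third side of a Euclidean hinge exceeds the difference of the legs by
    at most [e] times the shorter leg, then its cosine is at least [1 - e]. *)
Lemma cosine_near1 (u v d e x : R) : 0 < v -> v <= u -> 0 < e <= 1 -> 0 <= d ->
  d <= u - v + e * v -> d ^+ 2 = u ^+ 2 + v ^+ 2 - 2 * u * v * x -> 1 - e <= x.
Proof.
move=> v0 vu /andP[e0 e1] d0 de dE.
have u0 : 0 < u := lt_le_trans v0 vu.
have uv0 : 0 < 2 * u * v by rewrite !mulr_gt0.
have ev0 : 0 < e * v by exact: mulr_gt0.
have : d ^+ 2 <= (u - v + e * v) ^+ 2 by rewrite lerXn2r ?nnegrE //; lra.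
rewrite dE => h; rewrite -(ler_pM2l uv0).
have : 0 <= e * (2 - e) * v ^+ 2 by rewrite !mulr_ge0 ?sqr_ge0 //; lra.
rewrite (_ : (u - v + e * v) ^+ 2 = u ^+ 2 + v ^+ 2 - 2 * u * v * (1 - e) -
  e * (2 - e) * v ^+ 2) in h; last by ring.
lra.
Qed.

(** Linear independence excludes the angles 0 and pi.  The upper angle is a
    limit over hinges with arbitrary legs, whereas a ray only controls hinges
    with proportional ones.  For the angle pi proportional legs suffice, since
    the upper angle is a limit superior and is at most pi; for the angle 0
    the triangle inequality reduces arbitrary legs to equal ones. *)
Lemma linearly_independent_cos z (a b : geodesic_from z) k c :
  angle_cosine k a b c -> linearly_independent a b -> c ^+ 2 < 1.
Proof.
move=> hc [va vb up0 uppi]; have c1 := hc.1.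
have cn0 : c != 1.
  apply/eqP => cE; apply: up0.
  rewrite /upper_angle (limf_esup_cvg (l := 0)) // => e e0.
  (* [y] is the angle to go below, [e'] the error that it allows the cosine. *)
  pose y := Num.min e pi.
  have y0 : 0 < y by rewrite lt_min e0 pi_gt0.
  have yle : y <= e by rewrite ge_min lexx.
  have ypi : 0 <= y <= pi by rewrite (ltW y0) ge_min lexx orbT.
  have cy : 0 < 1 - cos y.
    by rewrite subr_gt0 -[ltRHS]cos0 ltr_cos ?in_itv //= lexx pi_ge0.
  pose e' := Num.min 1 (1 - cos y).
  have e'0 : 0 < e' by rewrite lt_min ltr01.
  have e'1 : e' <= 1 by rewrite ge_min lexx.
  have e'y : cos y <= 1 - e' by rewrite lerBrDl -lerBrDr ge_min lexx orbT.
  have := ray_distance hc va vb (t := (speed b)^-1) (s := (speed a)^-1).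
  rewrite !invr_gt0 => /(_ va vb _ e'0) /near_right_ex[m m0 hm].
  have van0 : speed a != 0 by rewrite gt_eqF.
  have vbn0 : speed b != 0 by rewrite gt_eqF.
  rewrite !divff // cE in hm.
  have {}hm r : 0 < r -> r < m -> mdist (a ((speed a)^-1 * r)) (b ((speed b)^-1 * r)) <= e' * r.
    move=> r0 /(hm r r0); rewrite (_ : _ - 2 * 1 * 1 * 1 = 0); last by ring.
    rewrite sqrtr0 subr0 ger0_norm; last by rewrite mulr_ge0 ?mdist_ge0 // invr_ge0 ltW.
    by rewrite mulrC ler_pdivrMr.
  pose N (v : R) dom := Num.min dom (m / v).
  exists ([set s | 0 < s /\ s < N (speed a) (geod_dom a)],
          [set t | 0 < t /\ t < N (speed b) (geod_dom b)]).
    have N0 (v dom : R) : 0 < v -> 0 < dom -> 0 < N v dom.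
      by move=> v0 dom0; rewrite /N lt_min dom0 divr_gt0.
    split; [apply: (near_right_small (N0 _ _ va (geod_dom_gt0 a))) |
            apply: (near_right_small (N0 _ _ vb (geod_dom_gt0 b)))] => r r0 rN //=.
  move=> [s t] /= [[s0]]; rewrite /N lt_min ltr_pdivlMr // => /andP[sa sm].
  move=> [t0]; rewrite lt_min ltr_pdivlMr // => /andP[tb tm].
  have hs : 0 < s <= geod_dom a by rewrite s0 ltW.
  have ht : 0 < t <= geod_dom b by rewrite t0 ltW.
  have [x [-> x1 xE]] := comparison_angleE va vb hs ht.
  rewrite subr0 ger0_norm ?acos_ge0 //; apply: le_trans yle.
  apply: acos_le => //; apply: le_trans e'y _.
  (* Cut the longer leg so that both have the length of the shorter one. *)
  pose u := speed a * s; pose v := speed b * t.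
  have u0 : 0 < u by exact: mulr_gt0.
  have v0 : 0 < v by exact: mulr_gt0.
  have um : u < m by rewrite /u mulrC.
  have vm : v < m by rewrite /v mulrC.
  have d0 := mdist_ge0 (a s) (b t).
  have sE : (speed a)^-1 * u = s by rewrite /u mulKf.
  have tE : (speed b)^-1 * v = t by rewrite /v mulKf.
  have [vu|uv] := leP v u.
    apply: (@cosine_near1 u v _ e' x v0 vu _ d0 _ xE); first by rewrite e'0.
    apply: le_trans (metric_triangle _ (a ((speed a)^-1 * v)) _) _.
    apply: lerD; last by have := hm v v0 vm; rewrite tE.
    have s'0 : 0 < (speed a)^-1 * v by rewrite mulr_gt0 ?invr_gt0.
    have s's : (speed a)^-1 * v <= s by rewrite -[leRHS]sE ler_pM2l ?invr_gt0.
    rewrite (@geod_pathP _ _ _ a); first last.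
    - by rewrite (ltW s'0) (le_trans s's) ?(ltW sa).
    - by rewrite (ltW s0) (ltW sa).
    by rewrite ger0_norm ?subr_ge0 // mulrBr mulVKf.
  apply: (@cosine_near1 v u (mdist (a s) (b t)) e' x u0 (ltW uv) _ d0 _ _).
  - by rewrite e'0.
  - apply: le_trans (metric_triangle _ (b ((speed b)^-1 * u)) _) _.
    rewrite addrC; apply: lerD; last by have := hm u u0 um; rewrite sE.
    have t'0 : 0 < (speed b)^-1 * u by rewrite mulr_gt0 ?invr_gt0.
    have t't : (speed b)^-1 * u <= t by rewrite -[leRHS]tE ler_pM2l ?invr_gt0 // ltW.
    rewrite (@geod_pathP _ _ _ b); first last.
    - by rewrite (ltW t0) (ltW tb).
    - by rewrite (ltW t'0) (le_trans t't) ?(ltW tb).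
    by rewrite distrC ger0_norm ?subr_ge0 // mulrBr mulVKf.
  - by rewrite xE -/u -/v; ring.
have cnN1 : c != -1.
  apply/eqP => cE; apply: uppi; rewrite /upper_angle.
  suff -> : limf_esup (fun st : R * R => (comparison_angle z (a st.1) (b st.2))%:E)
    (filter_prod (0 : R)^'+ (0 : R)^'+) = pi%:E by [].
  apply/eqP; rewrite eq_le; apply/andP; split.
    apply: (@limf_esup_le _ _ _ (fun st : R * R => comparison_angle z (a st.1) (b st.2)) _
      ([set s | 0 < s /\ s < geod_dom a] `*` [set t | 0 < t /\ t < geod_dom b])).
      exists ([set s | 0 < s /\ s < geod_dom a], [set t | 0 < t /\ t < geod_dom b]) => //.
      by split; [apply: (near_right_small (geod_dom_gt0 a)) |
        apply: (near_right_small (geod_dom_gt0 b))].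
    move=> [s t] /= [[s0 sa] [t0 tb]].
    have hs : 0 < s <= geod_dom a by rewrite s0 ltW.
    have ht : 0 < t <= geod_dom b by rewrite t0 ltW.
    by have [x [-> x1 _]] := comparison_angleE va vb hs ht; exact: acos_lepi.
  apply/lee_subgt0Pr => e e0; rewrite -EFinB.
  apply: limf_esup_ge => V [[P Q] /= [/near_right_ex[p p0 hP] /near_right_ex[q q0 hQ]] PQV].
  (* [y] is the angle to exceed.  If the third side is at least [2 - e'] times a
     leg, then the cosine is at most [2 e' - 1], hence at most [cos y]. *)
  pose y := pi - Num.min e pi.
  have m0 : 0 < Num.min e pi by rewrite lt_min e0 pi_gt0.
  have me : Num.min e pi <= e by rewrite ge_min lexx.
  have mpi : Num.min e pi <= pi by rewrite ge_min lexx orbT.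
  have ypi : 0 <= y <= pi by rewrite /y; apply/andP; split; lra.
  have cy : 0 < cos y + 1.
    suff : cos pi < cos y by rewrite cospi; lra.
    rewrite ltr_cos ?in_itv //=; first by rewrite /y; lra.
    by rewrite lexx pi_ge0.
  pose e' := Num.min 1 ((cos y + 1) / 2).
  have e'0 : 0 < e' by rewrite lt_min ltr01 divr_gt0.
  have e'1 : e' <= 1 by rewrite ge_min lexx.
  have e'y : e' <= (cos y + 1) / 2 by rewrite ge_min lexx orbT.
  have := ray_distance hc va vb (t := (speed b)^-1) (s := (speed a)^-1).
  rewrite !invr_gt0 => /(_ va vb _ e'0) /near_right_ex[r1 r10 hr1].
  have van0 : speed a != 0 by rewrite gt_eqF.
  have vbn0 : speed b != 0 by rewrite gt_eqF.
  rewrite !divff // cE in hr1.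
  pose r2 := Num.min r1 (Num.min (Num.min (p * speed a) (q * speed b))
    (Num.min (geod_dom a * speed a) (geod_dom b * speed b))).
  have r20 : 0 < r2 by rewrite /r2 !lt_min r10 !mulr_gt0 ?geod_dom_gt0.
  pose r := r2 / 2.
  have r0 : 0 < r by rewrite divr_gt0.
  have : r < r2 by rewrite /r; lra.
  rewrite /r2 !lt_min -!ltr_pdivrMr // => /and3P[rr1 /andP[rp rq] /andP[ra rb]].
  have ra0 : 0 < r / speed a by exact: divr_gt0.
  have rb0 : 0 < r / speed b by exact: divr_gt0.
  exists (r / speed a, r / speed b).
    by apply: PQV; split => /=; [exact: hP | exact: hQ].
  have hs : 0 < r / speed a <= geod_dom a by rewrite ra0 ltW.
  have ht : 0 < r / speed b <= geod_dom b by rewrite rb0 ltW.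
  have [x [/= -> x1 xE]] := comparison_angleE va vb hs ht.
  apply: (@le_trans _ _ y); first by rewrite /y; lra.
  apply: acos_ge => //.
  have := hr1 r r0 rr1; rewrite (_ : _ - 2 * 1 * 1 * -1 = 2 ^+ 2); last by ring.
  rewrite sqrtr_sqr (ger0_norm (x := 2)) // ler_distl => /andP[+ _].
  rewrite ![_^-1 * r]mulrC ler_pdivlMl //.
  move: xE; rewrite ![_ * (r / _)]mulrC !divfK //.
  set d := mdist _ _ => dE dr.
  have : (r * (2 - e')) ^+ 2 <= d ^+ 2.
    by rewrite lerXn2r ?nnegrE ?mdist_ge0 // mulr_ge0 ?(ltW r0) //; lra.
  have r2' : 0 < r ^+ 2 by exact: exprn_gt0.
  rewrite dE (_ : r ^+ 2 + r ^+ 2 - 2 * r * r * x = r ^+ 2 * (2 - 2 * x)); last by ring.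
  rewrite exprMn ler_pM2l // sqrrB; nra.
rewrite -subr_gt0 (_ : 1 - c ^+ 2 = (1 - c) * (c - -1)); last by ring.
move: c1; rewrite ler_norml => /andP[cN cP].
by rewrite mulr_gt0 // subr_gt0 lt_neqAle ?cP ?cn0 // eq_sym cnN1.
Qed.

Lemma sec_quotient_bounds z (a b : geodesic_from z) k c (s t : R^nat) (eps : R) :
  angle_cosine k a b c -> linearly_independent a b ->
  comparable_null_sequences s t -> 0 < eps ->
  \forall j \near \oo,
    (c <= hinge_cos k a b (s j) (t j) -> k - eps <= sec_quotient a b (s j) (t j)) /\
    (hinge_cos k a b (s j) (t j) <= c -> sec_quotient a b (s j) (t j) <= k + eps).
Proof.
move=> hc ind [st0 s0 t0 [C stC]] e0.
have c2 := linearly_independent_cos hc ind; have [va vb _ _] := ind.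
(* [C'] bounds [(u + v)^2 / (u v)] for the legs [u] and [v] of the hinges. *)
pose C' := ((speed a ^+ 2 + speed b ^+ 2) * C + 2 * speed a * speed b) /
  (speed a * speed b).
have [r0 r00 H] := normalized_defect_bounds k C' c2 e0.
have r_cvg : speed a * s j + speed b * t j @[j --> \oo] --> 0.
  rewrite -[X in _ --> X](_ : speed a * 0 + speed b * 0 = 0); last by rewrite !mulr0 addr0.
  by apply: cvgD; apply: cvgMr.
near=> j.
have [sj tj] := st0 j.
have u0 : 0 < speed a * s j by exact: mulr_gt0.
have v0 : 0 < speed b * t j by exact: mulr_gt0.
have hs : 0 <= s j <= geod_dom a.
  rewrite ltW //=; near: j; apply: (cvgr_le _ s0); exact: geod_dom_gt0.
have ht : 0 <= t j <= geod_dom b.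
  rewrite ltW //=; near: j; apply: (cvgr_le _ t0); exact: geod_dom_gt0.
have rj : speed a * s j + speed b * t j < r0.
  by near: j; apply: (cvgr_lt _ r_cvg).
have ur : 0 < speed a * s j <= speed a * s j + speed b * t j by rewrite u0 lerDl ltW.
have vr : 0 < speed b * t j <= speed a * s j + speed b * t j by rewrite v0 lerDr ltW.
have dr : 0 <= mdist (a (s j)) (b (t j)) <= speed a * s j + speed b * t j.
  by rewrite mdist_ge0 hinge_le.
have comp : (speed a * s j + speed b * t j) ^+ 2 <= C' * (speed a * s j * (speed b * t j)).
  have -> : C' * (speed a * s j * (speed b * t j)) =
    ((speed a ^+ 2 + speed b ^+ 2) * C + 2 * speed a * speed b) * (s j * t j).
    by rewrite /C'; field; rewrite !gt_eqF.
  have := stC j; have -> : s j / t j + t j / s j = (s j ^+ 2 + t j ^+ 2) / (s j * t j).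
    by field; rewrite !gt_eqF.
  rewrite ler_pdivrMr ?mulr_gt0 // => hC.
  have a2 := sqr_ge0 (speed a); have b2 := sqr_ge0 (speed b).
  have s2 := sqr_ge0 (s j); have t2 := sqr_ge0 (t j).
  have ha : speed a ^+ 2 * s j ^+ 2 <= speed a ^+ 2 * (C * (s j * t j)).
    by rewrite ler_wpM2l //; lra.
  have hb : speed b ^+ 2 * t j ^+ 2 <= speed b ^+ 2 * (C * (s j * t j)).
    by rewrite ler_wpM2l //; lra.
  rewrite sqrrD !exprMn -mulr_natl; lra.
suff -> : sec_quotient a b (s j) (t j) =
  3 * (((speed a * s j) ^+ 2 + (speed b * t j) ^+ 2 - 2 * (speed a * s j) * (speed b * t j) * c -
      mdist (a (s j)) (b (t j)) ^+ 2) /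
    ((speed a * s j) ^+ 2 * (speed b * t j) ^+ 2 * (1 - c ^+ 2))).
  exact: H rj ur vr dr comp.
rewrite /sec_quotient (dir_dist_rescale hc) // (dir_inner_cos hc) // sqr_sqrtr.
  by congr (3 * (_ / _)); ring.
by apply: law_of_cosines_ge0; [exact: hc.1 | exact: ltW | exact: ltW].
Unshelve. all: by end_near. Qed.

Lemma near_comparable_null (s t : R^nat) (delta : R) :
  comparable_null_sequences s t -> 0 < delta ->
  \forall j \near \oo, 0 < s j < delta /\ 0 < t j < delta.
Proof.
move=> [st0 s0 t0 _] d0; near=> j; have [sj tj] := st0 j; rewrite sj tj; split.
  by near: j; apply: (cvgr_lt _ s0).
by near: j; apply: (cvgr_lt _ t0).
Unshelve. all: by end_near. Qed.

End SectionalCurvature.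

Theorem theorem2p4 (R : realType) (X : completeMetricType R)
    (hX : geodesic_space X) (z : X) (kappa lambda : R) :
  (curvature_ge_near z kappa ->
    forall a b : geodesic_from z, linearly_independent a b ->
      lower_sec_ge a b kappa) /\
  (curvature_le_near z lambda ->
    forall a b : geodesic_from z, linearly_independent a b ->
      upper_sec_le a b lambda).
Proof.
split => curv a b ind s t st; have [va vb _ _] := ind.
- have [c [hc [delta d0 hd]]] := angle_cosine_ge hX curv va vb.
  apply: le_limn_einf => eps e0; near=> j.
  have [hs ht] : 0 < s j < delta /\ 0 < t j < delta.
    by near: j; exact: near_comparable_null.
  have [+ _] : (c <= hinge_cos kappa a b (s j) (t j) ->
      kappa - eps <= sec_quotient a b (s j) (t j)) /\
    (hinge_cos kappa a b (s j) (t j) <= c ->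
      sec_quotient a b (s j) (t j) <= kappa + eps).
    by near: j; exact: sec_quotient_bounds.
  by apply; exact: hd.
- have [c [hc [delta d0 hd]]] := angle_cosine_le hX curv va vb.
  apply: limn_esup_le => eps e0; near=> j.
  have [hs ht] : 0 < s j < delta /\ 0 < t j < delta.
    by near: j; exact: near_comparable_null.
  have [_] : (c <= hinge_cos lambda a b (s j) (t j) ->
      lambda - eps <= sec_quotient a b (s j) (t j)) /\
    (hinge_cos lambda a b (s j) (t j) <= c ->
      sec_quotient a b (s j) (t j) <= lambda + eps).
    by near: j; exact: sec_quotient_bounds.
  by apply; exact: hd.
Unshelve. all: by end_near. Qed.
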